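(* The $\ell$-spectrum of the Abelian $\ell$-group with order-unit $G_{\omega_1^{\mathrm{op}}}$ cannot be embedded, as a spectral subspace, into the Brumfiel spectrum of any commutative $f$-ring (that is, it is not homeomorphic to any spectral subspace of such a Brumfiel spectrum). Hence, it also cannot be embedded, as a spectral subspace, into the real spectrum of any commutative unital ring.
   Context: ''Compact'' does not include Hausdorff. A topological space is sober if every join-irreducible member of the lattice of its closed subsets is the closure of a unique singleton. It is generalized spectral if it is sober, its compact open subsets form a basis, and the intersection of any two compact open subsets is compact; it is spectral if moreover it is compact. A map between topological spaces is spectral if the inverse image of every compact open set is compact open. A generalized spectral space $X$ is a spectral subspace of a generalized spectral space $Y$ if $X\subseteq Y$, $X$ carries the topology induced by $Y$, and the inclusion map $X\to Y$ is spectral. An $\ell$-group is a group with a translation-invariant lattice ordering. An $\ell$-ideal of an Abelian $\ell$-group $G$ is a subgroup that is also an order-convex sublattice. A prime $\ell$-ideal is a proper $\ell$-ideal $P$ such that $x\wedge y\in P$ implies $x\in P$ or $y\in P$. The $\ell$-spectrum of $G$ is the set of all prime $\ell$-ideals of $G$, with closed sets exactly the sets $\{P : I\subseteq P\}$ for $I\subseteq G$. A lattice-ordered ring is a ring (not necessarily unital) with a lattice ordering invariant under additive translations and preserved by multiplication by positive elements; it is an $f$-ring if for all $x,y,z\geq 0$, $x\wedge y=0$ implies $x\wedge yz=x\wedge zy=0$. An $\ell$-ideal of an $f$-ring is a ring ideal that is also an order-convex sublattice. A prime $\ell$-ideal of a commutative $f$-ring is a proper $\ell$-ideal that is prime as a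 ring ideal. The Brumfiel spectrum of a commutative $f$-ring $A$ is the set of all its prime $\ell$-ideals, with closed sets exactly the sets $\{P: I\subseteq P\}$ for $I\subseteq A$. For a commutative unital ring $R$, a cone is a subset that is both an additive and a multiplicative submonoid of $R$ and contains all squares. A cone $P$ is prime if $R=P\cup(-P)$ and $P\cap(-P)$ is a prime ideal of $R$. The real spectrum of $R$ is the set of all prime cones of $R$, with the topology generated by the sets $\{P : a\notin P\}$, $a\in R$. For a chain $\Lambda$, $\mathbb{Z}\langle\Lambda\rangle$ is the totally ordered Abelian group that is free Abelian on generators $c_\xi$ ($\xi\in\Lambda$), in which an element $x=\sum_{i=1}^n k_ic_{\xi_i}$ with each $k_i\in\mathbb{Z}\setminus\{0\}$ and $\xi_1<\cdots<\xi_n$ in $\Lambda$ is $\geq0$ iff $n=0$ or $k_n>0$. For partially ordered Abelian groups $G$, $H$, the lexicographical product $G\times_{\mathrm{lex}}H$ is the group $G\times H$ with positive cone the set of all $(x,y)$ with $x>0$, or $x=0$ and $y\geq0$. $F$ denotes the free Abelian $\ell$-group defined by generators $a$, $b$ subject to the relations $a\geq0$ and $b\geq0$. Set $G_\Lambda=\mathbb{Z}\langle\Lambda\rangle\times_{\mathrm{lex}}F$. $\omega_1^{\mathrm{op}}$ is the first uncountable ordinal $\omega_1$ with the opposite order. *)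

(* Defs.v *)
From HB Require Import structures.
From mathcomp Require Import all_boot all_order all_algebra.
From mathcomp.multinomials Require Import freeg.
From mathcomp Require Import all_classical topology.
From mathcomp Require wochoice.

Set Implicit Arguments.
Unset Strict Implicit.
Unset Printing Implicit Defensive.
Import Order.TTheory GRing.Theory Num.Theory.
Local Open Scope classical_set_scope.
Local Open Scope ring_scope.

(* The empty closed set is the bottom of the lattice of closed sets, so it is
   not join-irreducible. *)
Definition join_irreducible_closed (X : topologicalType) (C : set X) : Prop :=
  [/\ closed C, C !=set0 &
      forall A B : set X, closed A -> closed B -> C = A `|` B ->
        C = A \/ C = B].

Definition sober (X : topologicalType) : Prop :=
  forall C : set X, join_irreducible_closed C ->
    exists! x : X, C = closure [set x].

Definition compact_open (X : topologicalType) : set (set X) :=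
  [set U | compact U /\ open U].

Definition generalized_spectral (X : topologicalType) : Prop :=
  [/\ sober X, basis (@compact_open X) &
      forall U V : set X, compact_open U -> compact_open V ->
        compact (U `&` V)].

Definition spectral_map (X Y : topologicalType) (f : X -> Y) : Prop :=
  forall V : set Y, compact_open V -> compact_open (f @^-1` V).

(* [set_type Z] carries the topology induced by Y. *)
Definition spectral_subspace (Y : topologicalType) (Z : set Y) : Prop :=
  [/\ generalized_spectral Y, generalized_spectral (set_type Z) &
      spectral_map (set_val : set_type Z -> Y)].

Definition homeomorphic (X Y : topologicalType) : Prop :=
  exists f : X -> Y, exists g : Y -> X,
    [/\ cancel f g, cancel g f, continuous f & continuous g].

Definition embeds_as_spectral_subspace (X Y : topologicalType) : Prop :=
  exists Z : set Y, spectral_subspace Z /\ homeomorphic X (set_type Z).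

HB.mixin Record isPOAbGroup G of Num.POrderedZmodule G :=
  { lg_leD2l : forall x y z : G, x <= y -> z + x <= z + y }.

#[short(type="poAbGroupType")]
HB.structure Definition POAbGroup :=
  { G of isPOAbGroup G & Num.POrderedZmodule G }.

HB.mixin Record POAbGroup_isTotal G of POAbGroup G :=
  { lg_le_total : total (fun x y : G => x <= y) }.

#[short(type="totalAbGroupType")]
HB.structure Definition TotalAbGroup := { G of POAbGroup_isTotal G & POAbGroup G }.

(* The lattice operations are not taken from [Order.Lattice]: the hierarchy
   already has [Num.RealDomain] as the join of [Order.Lattice] and
   [GRing.Zmodule], so a weaker join of the two cannot be declared. *)
HB.mixin Record POAbGroup_isLGroup G of POAbGroup G := {
  lg_meet : G -> G -> G;
  lg_join : G -> G -> G;
  lg_lexI : forall x y z : G, (x <= lg_meet y z) = (x <= y) && (x <= z);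
  lg_leUx : forall x y z : G, (lg_join x y <= z) = (x <= z) && (y <= z) }.

#[short(type="abLGroupType")]
HB.structure Definition AbLGroup := { G of POAbGroup_isLGroup G & POAbGroup G }.

Definition lgroup_hom (G H : abLGroupType) (f : G -> H) : Prop :=
  [/\ {morph f : x y / x + y},
      {morph f : x y / lg_meet x y} &
      {morph f : x y / lg_join x y}].

Definition order_unit (G : poAbGroupType) (u : G) : Prop :=
  0 <= u /\ forall x : G, exists n : nat, x <= u *+ n.

Section POAbGroupTheory.
Variable G : poAbGroupType.
Implicit Types x y z : G.

Lemma lg_leD x y z t : x <= y -> z <= t -> x + z <= y + t.
Proof.
move=> xy zt; apply: (@le_trans _ _ (y + z)); last exact: lg_leD2l.
by rewrite ![_ + z]addrC; exact: lg_leD2l.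
Qed.

Lemma lg_leN2 x y : x <= y -> - y <= - x.
Proof.
move=> /(lg_leD2l _ _ (- x - y)).
by rewrite addrAC addNr add0r -addrA addNr addr0.
Qed.

Lemma lg_subr_ge0 x y : (0 <= y - x) = (x <= y).
Proof.
apply/idP/idP => [/(lg_leD2l _ _ x)|/(lg_leD2l _ _ (- x))].
  by rewrite addr0 addrCA subrr addr0.
by rewrite addNr addrC.
Qed.

End POAbGroupTheory.

Section AbLGroupTheory.
Variable G : abLGroupType.
Implicit Types x y z : G.

Lemma lg_leIl x y : lg_meet x y <= x.
Proof. by have := lexx (lg_meet x y); rewrite lg_lexI => /andP[]. Qed.

Lemma lg_leIr x y : lg_meet x y <= y.
Proof. by have := lexx (lg_meet x y); rewrite lg_lexI => /andP[]. Qed.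

Lemma lg_leUl x y : x <= lg_join x y.
Proof. by have := lexx (lg_join x y); rewrite lg_leUx => /andP[]. Qed.

Lemma lg_leUr x y : y <= lg_join x y.
Proof. by have := lexx (lg_join x y); rewrite lg_leUx => /andP[]. Qed.

End AbLGroupTheory.

Definition order_convex (G : poAbGroupType) (I : set G) : Prop :=
  forall x y z : G, I x -> I z -> x <= y -> y <= z -> I y.

Definition lideal (G : abLGroupType) (I : set G) : Prop :=
  [/\ [/\ I 0, (forall x y, I x -> I y -> I (x + y)) &
          forall x, I x -> I (- x)],
      (forall x y, I x -> I y -> I (lg_meet x y) /\ I (lg_join x y)) &
      order_convex I].

Definition prime_lideal (G : abLGroupType) (P : set G) : Prop :=
  [/\ lideal P, P <> setT & forall x y, P (lg_meet x y) -> P x \/ P y].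

Record lspectrum (G : abLGroupType) := LSpectrum {
  lspectrum_set :> set G;
  lspectrum_prime : prime_lideal lspectrum_set }.

Definition lspectrum_V (G : abLGroupType) (I : set G) : set (lspectrum G) :=
  [set P : lspectrum G | I `<=` P].

Section LSpectrumTopology.
Variable G : abLGroupType.

HB.instance Definition _ := gen_eqMixin (lspectrum G).
HB.instance Definition _ := gen_choiceMixin (lspectrum G).

Definition lspectrum_open : set_system (lspectrum G) :=
  [set ~` lspectrum_V I | I in [set: set G]].

Let openT : lspectrum_open setT.
Proof.
exists setT => //; apply/seteqP; split=> // P _ sP.
have [_ PT _] := lspectrum_prime P; apply: PT; apply/seteqP; split=> //.
Qed.

Let lspectrum_posI (P : lspectrum G) (x : G) :
  ~ lspectrum_set P x -> exists2 u, 0 <= u &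
    ~ lspectrum_set P u /\
    forall Q : lspectrum G, lspectrum_set Q x -> lspectrum_set Q u.
Proof.
move=> Px.
have posQ (y : G) (Q : lspectrum G) : lspectrum_set Q y ->
    lspectrum_set Q (lg_join y 0).
  by case: Q => Q [[[Q0 _ _] QL _] _ _] /= Qy; have [] := QL _ _ Qy Q0.
have [Pp|] := pselect (lspectrum_set P (lg_join x 0)); last first.
  by move=> nP; exists (lg_join x 0); [exact: lg_leUr | split=> // Q; exact: posQ].
have [Pn|] := pselect (lspectrum_set P (lg_join (- x) 0)); last first.
  move=> nP; exists (lg_join (- x) 0); first exact: lg_leUr.
  split=> // Q Qx; apply: posQ.
  by case: Q Qx => Q [[[_ _ QN] _ _] _ _] /=; exact: QN.
case: Px; case: P Pp Pn => P [[[P0 PD PN] PL Pc] _ _] /= Pp Pn.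
apply: (Pc (- lg_join (- x) 0) x (lg_join x 0)) => //.
- exact: PN.
- by rewrite -[leRHS]opprK; apply: lg_leN2; exact: lg_leUl.
- exact: lg_leUl.
Qed.

Let openI : setI_closed lspectrum_open.
Proof.
move=> _ _ [I _ <-] [J _ <-].
pose K := [set x | forall P : lspectrum G, I `<=` P \/ J `<=` P ->
  lspectrum_set P x].
exists K => //; apply/seteqP; split=> P /=.
  move=> nK; split=> sP; apply: nK => x; apply; by [left|right].
move=> [nI nJ] sP.
have [x xI Px] : exists2 x, I x & ~ lspectrum_set P x.
  by apply: contra_notP nI => h x xI; apply: contra_notP h => Px; exists x.
have [y yJ Py] : exists2 x, J x & ~ lspectrum_set P x.
  by apply: contra_notP nJ => h z zJ; apply: contra_notP h => Pz; exists z.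
have [u u0 [Pu Qu]] := lspectrum_posI Px.
have [v v0 [Pv Qv]] := lspectrum_posI Py.
have w0 : 0 <= lg_meet u v by rewrite lg_lexI u0.
have : lspectrum_set P (lg_meet u v).
  apply: sP => Q [IQ|JQ].
  - have {}Qu := Qu _ (IQ _ xI).
    have [[[Q0 _ _] _ Qc] _ _] := lspectrum_prime Q.
    by apply: (Qc 0 _ u) => //; exact: lg_leIl.
  - have {}Qv := Qv _ (JQ _ yJ).
    have [[[Q0 _ _] _ Qc] _ _] := lspectrum_prime Q.
    by apply: (Qc 0 _ v) => //; exact: lg_leIr.
by have [_ _ Pp] := lspectrum_prime P => /Pp[].
Qed.

Let open_bigU (I : Type) (f : I -> set (lspectrum G)) :
  (forall i, lspectrum_open (f i)) -> lspectrum_open (\bigcup_i f i).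
Proof.
move=> fo.
exists [set x | exists i J, f i = ~` lspectrum_V J /\ J x] => //.
apply/seteqP; split=> P /=.
  move=> nP; apply: contra_notP nP => nf x [i [J [fJ Jx]]].
  apply: contra_notP nf => Px; exists i => //.
  by rewrite fJ => /(_ _ Jx).
move=> [i _ fP] sP; have [J _ fJ] := fo i.
by move: (fP); rewrite -fJ; apply=> x Jx; apply: sP; exists i, J.
Qed.

HB.instance Definition _ :=
  isOpenTopological.Build (lspectrum G) openT openI open_bigU.

Lemma closed_lspectrumP (C : set (lspectrum G)) :
  closed C <-> exists I : set G, C = lspectrum_V I.
Proof.
rewrite -openC; split=> [[I _ IC]|[I ->]]; last by exists I.
by exists I; rewrite -[C]setCK -IC setCK.
Qed.

End LSpectrumTopology.

(* Rings need not be unital here, so multiplication is not that of [GRing]. *)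
HB.mixin Record AbLGroup_isLRing A of AbLGroup A := {
  lr_mul : A -> A -> A;
  lr_mulA : associative lr_mul;
  lr_mulDl : left_distributive lr_mul +%R;
  lr_mulDr : right_distributive lr_mul +%R;
  lr_le_mul2l : forall x y z : A, 0 <= z -> x <= y -> lr_mul z x <= lr_mul z y;
  lr_le_mul2r : forall x y z : A, 0 <= z -> x <= y -> lr_mul x z <= lr_mul y z }.

#[short(type="lRingType")]
HB.structure Definition LRing := { A of AbLGroup_isLRing A & AbLGroup A }.

HB.mixin Record LRing_isFRing A of LRing A := {
  fr_meet_mul : forall x y z : A, 0 <= x -> 0 <= y -> 0 <= z ->
    lg_meet x y = 0 ->
    lg_meet x (lr_mul y z) = 0 /\ lg_meet x (lr_mul z y) = 0 }.

#[short(type="fRingType")]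
HB.structure Definition FRing := { A of LRing_isFRing A & LRing A }.

HB.mixin Record FRing_isCommutative A of FRing A :=
  { fr_mulC : commutative (@lr_mul A) }.

#[short(type="comFRingType")]
HB.structure Definition ComFRing := { A of FRing_isCommutative A & FRing A }.

Definition fring_lideal (A : fRingType) (I : set A) : Prop :=
  lideal I /\ forall a x, I x -> I (lr_mul a x) /\ I (lr_mul x a).

Definition fring_prime_lideal (A : comFRingType) (P : set A) : Prop :=
  [/\ fring_lideal P, P <> setT & forall x y, P (lr_mul x y) -> P x \/ P y].

Record brumfiel_spectrum (A : comFRingType) := BrumfielSpectrum {
  brumfiel_set :> set A;
  brumfiel_prime : fring_prime_lideal brumfiel_set }.

Definition brumfiel_V (A : comFRingType) (I : set A) :
  set (brumfiel_spectrum A) := [set P : brumfiel_spectrum A | I `<=` P].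

Section BrumfielTopology.
Variable A : comFRingType.

HB.instance Definition _ := gen_eqMixin (brumfiel_spectrum A).
HB.instance Definition _ := gen_choiceMixin (brumfiel_spectrum A).

Definition brumfiel_open : set_system (brumfiel_spectrum A) :=
  [set ~` brumfiel_V I | I in [set: set A]].

Let openT : brumfiel_open setT.
Proof.
exists setT => //; apply/seteqP; split=> // P _ sP.
have [_ PT _] := brumfiel_prime P; apply: PT; apply/seteqP; split=> //.
Qed.

Let openI : setI_closed brumfiel_open.
Proof.
move=> _ _ [I _ <-] [J _ <-].
exists [set z | exists x y, [/\ I x, J y & z = lr_mul x y]] => //.
apply/seteqP; split=> P /=.
  have [[_ PM] _ _] := brumfiel_prime P.
  by move=> nK; split=> sP; apply: nK => _ [x [y [Ix Jy ->]]];
     [have /(PM y)[] := sP _ Ix | have /(PM x)[] := sP _ Jy].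
move=> [nI nJ] sP.
have [x xI Px] : exists2 x, I x & ~ brumfiel_set P x.
  by apply: contra_notP nI => h x xI; apply: contra_notP h => Px; exists x.
have [y yJ Py] : exists2 x, J x & ~ brumfiel_set P x.
  by apply: contra_notP nJ => h z zJ; apply: contra_notP h => Pz; exists z.
have [_ _ Pp] := brumfiel_prime P.
have /Pp[//|//] : brumfiel_set P (lr_mul x y) by apply: sP; exists x, y.
Qed.

Let open_bigU (I : Type) (f : I -> set (brumfiel_spectrum A)) :
  (forall i, brumfiel_open (f i)) -> brumfiel_open (\bigcup_i f i).
Proof.
move=> fo.
exists [set x | exists i J, f i = ~` brumfiel_V J /\ J x] => //.
apply/seteqP; split=> P /=.
  move=> nP; apply: contra_notP nP => nf x [i [J [fJ Jx]]].
  apply: contra_notP nf => Px; exists i => //.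
  by rewrite fJ => /(_ _ Jx).
move=> [i _ fP] sP; have [J _ fJ] := fo i.
by move: (fP); rewrite -fJ; apply=> x Jx; apply: sP; exists i, J.
Qed.

HB.instance Definition _ :=
  isOpenTopological.Build (brumfiel_spectrum A) openT openI open_bigU.

Lemma closed_brumfielP (C : set (brumfiel_spectrum A)) :
  closed C <-> exists I : set A, C = brumfiel_V I.
Proof.
rewrite -openC; split=> [[I _ IC]|[I ->]]; last by exists I.
by exists I; rewrite -[C]setCK -IC setCK.
Qed.

End BrumfielTopology.

Definition prime_ideal (R : comPzRingType) (I : set R) : Prop :=
  [/\ [/\ I 0, (forall x y, I x -> I y -> I (x + y)) &
          forall a x, I x -> I (a * x)],
      I <> setT & forall x y, I (x * y) -> I x \/ I y].

Definition cone (R : comPzRingType) (P : set R) : Prop :=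
  [/\ P 0 /\ (forall x y, P x -> P y -> P (x + y)),
      P 1 /\ (forall x y, P x -> P y -> P (x * y)) &
      forall x, P (x ^+ 2)].

Definition prime_cone (R : comPzRingType) (P : set R) : Prop :=
  [/\ cone P, (forall x, P x \/ P (- x)) &
      prime_ideal [set x | P x /\ P (- x)]].

Record real_spectrum (R : comPzRingType) := RealSpectrum {
  real_spectrum_set :> set R;
  real_spectrum_prime : prime_cone real_spectrum_set }.

Section RealSpectrumTopology.
Variable R : comPzRingType.

HB.instance Definition _ := gen_eqMixin (real_spectrum R).
HB.instance Definition _ := gen_choiceMixin (real_spectrum R).

Definition real_spectrum_subbase : set_system (real_spectrum R) :=
  [set [set P : real_spectrum R | ~ real_spectrum_set P a] | a in [set: R]].

HB.instance Definition _ :=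
  isSubBaseTopological.Build (real_spectrum R) real_spectrum_subbase id.

End RealSpectrumTopology.

Section ConeOrder.
Variables (G : zmodType) (c : pred G).
Hypothesis c0 : c 0.
Hypothesis cD : forall x y, c x -> c y -> c (x + y).
Hypothesis cN : forall x, c x -> c (- x) -> x = 0.

Definition cone_le : rel G := fun x y => c (y - x).

Lemma cone_le_refl : reflexive cone_le.
Proof. by move=> x; rewrite /cone_le subrr. Qed.

Lemma cone_le_anti : antisymmetric cone_le.
Proof.
move=> x y /andP[xy yx]; apply/esym/eqP; rewrite -subr_eq0; apply/eqP.
by apply: cN => //; rewrite opprB.
Qed.

Lemma cone_le_trans : transitive cone_le.
Proof.
by move=> y x z xy yz; rewrite /cone_le -(subrKA y); exact: cD.
Qed.

Lemma cone_leD2l x y z : cone_le x y -> cone_le (z + x) (z + y).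
Proof. by rewrite /cone_le opprD addrACA subrr add0r. Qed.

Lemma cone_le0 x : cone_le 0 x = c x.
Proof. by rewrite /cone_le subr0. Qed.

End ConeOrder.

Definition lexZ (d : Order.disp_t) (L : orderType d) : Type := {freeg L}.

Section LexZ.
Context {d : Order.disp_t} {L : orderType d}.

HB.instance Definition _ := GRing.Zmodule.on (lexZ L).

(* [dom x] lists the generators with nonzero coefficient in [x]. *)
Definition lexZ_ge0 (x : lexZ L) : bool :=
  (x == 0) ||
  has (fun xi => all (fun eta => (eta <= xi)%O) (dom x) && (0 < coeff xi x))
      (dom x).

Lemma lexZ_ge0P (x : lexZ L) :
  lexZ_ge0 x <-> x = 0 \/ exists2 xi, 0 < coeff xi x &
    forall eta, (xi < eta)%O -> coeff eta x = 0.
Proof.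
rewrite /lexZ_ge0; split=> [/orP[/eqP ->|/hasP[xi xix /andP[/allP h c0]]]|].
- by left.
- right; exists xi => // eta xieta; apply/eqP/negPn/negP => ce.
  have /h : eta \in dom x by rewrite mem_dom.
  by rewrite leNgt xieta.
- case=> [->|[xi c0 h]]; first by rewrite eqxx.
  apply/orP; right; apply/hasP; exists xi; first by rewrite mem_dom gt_eqF.
  rewrite c0 andbT; apply/allP => eta; rewrite mem_dom => ce.
  by rewrite leNgt; apply/negP => /h ce0; rewrite ce0 eqxx in ce.
Qed.

Let ge0_0 : lexZ_ge0 0.
Proof. by rewrite /lexZ_ge0 eqxx. Qed.

Let ge0_D (x y : lexZ L) : lexZ_ge0 x -> lexZ_ge0 y -> lexZ_ge0 (x + y).
Proof.
move=> /lexZ_ge0P[->|[xi cx hx]]; first by rewrite add0r.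
move=> /lexZ_ge0P[->|[eta cy hy]].
  by rewrite addr0; apply/lexZ_ge0P; right; exists xi.
apply/lexZ_ge0P; right; have [xe|ex|xe] := ltgtP xi eta.
- exists eta; first by rewrite coeffD hx// add0r.
  by move=> z ez; rewrite coeffD hy// hx ?addr0//; exact: lt_trans ez.
- exists xi; first by rewrite coeffD hy// addr0.
  by move=> z ez; rewrite coeffD hx// hy ?addr0//; exact: lt_trans ez.
- exists xi; first by rewrite coeffD addr_gt0// xe.
  by move=> z ez; rewrite coeffD hx// hy ?addr0// -xe.
Qed.

Let ge0_N (x : lexZ L) : lexZ_ge0 x -> lexZ_ge0 (- x) -> x = 0.
Proof.
move=> /lexZ_ge0P[//|[xi cx hx]] /lexZ_ge0P[/eqP|[eta]].
  by rewrite oppr_eq0 => /eqP.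
rewrite coeffN oppr_gt0 => cy hy; have [xe|ex|xe] := ltgtP xi eta.
- by rewrite hx ?ltxx in cy.
- by move: (hy _ ex); rewrite coeffN => /eqP; rewrite oppr_eq0 gt_eqF.
- by move: cy; rewrite -xe => /(lt_trans cx); rewrite ltxx.
Qed.

HB.instance Definition _ := Order.Le_isPOrder.Build ring_display (lexZ L)
  (@cone_le_refl _ _ ge0_0) (@cone_le_anti _ _ ge0_N) (@cone_le_trans _ _ ge0_D).

HB.instance Definition _ := isPOAbGroup.Build (lexZ L)
  (@cone_leD2l _ lexZ_ge0).

Lemma lexZ_le0E (x : lexZ L) : (0 <= x) = lexZ_ge0 x.
Proof. exact: cone_le0. Qed.

Let exists_max (s : seq L) : s != [::] ->
  exists2 m, m \in s & forall x, x \in s -> (x <= m)%O.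
Proof.
elim: s => // a [|b s] IH _.
  by exists a => [|x]; rewrite inE // => /eqP ->.
have [//|m ms hm] := IH; have [am|ma] := leP a m.
  by exists m => [|x]; rewrite in_cons ?ms ?orbT// => /orP[/eqP ->//|/hm].
exists a => [|x]; first exact: mem_head.
by rewrite in_cons => /orP[/eqP ->//|/hm xm]; exact: le_trans (ltW ma).
Qed.

Let ge0_total : total (fun x y : lexZ L => x <= y).
Proof.
move=> x y; rewrite -(lg_subr_ge0 x) -(lg_subr_ge0 y) -(opprB y x) !lexZ_le0E.
move: (y - x) => {x y} z; have [->|z0] := eqVneq z 0; first by rewrite ge0_0.
have [|xi] := @exists_max (dom z); first by rewrite dom_eq0.
rewrite mem_dom => cxi hxi.
have h eta : (xi < eta)%O -> coeff eta z = 0.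
  by move=> xe; apply: coeff_outdom; apply/negP => /hxi; rewrite leNgt xe.
have [c0|c0] := ltP 0 (coeff xi z); apply/orP.
  by left; apply/lexZ_ge0P; right; exists xi.
right; apply/lexZ_ge0P; right; exists xi.
  by rewrite coeffN oppr_gt0 lt_neqAle cxi.
by move=> eta /h; rewrite coeffN => ->; rewrite oppr0.
Qed.

HB.instance Definition _ := POAbGroup_isTotal.Build (lexZ L) ge0_total.

End LexZ.

Definition lexprod (G H : poAbGroupType) : Type := (G * H)%type.

Section LexProd.
Variables G H : poAbGroupType.

HB.instance Definition _ := GRing.Zmodule.on (lexprod G H).

Definition lexprod_ge0 (z : lexprod G H) : bool :=
  (0 < z.1) || (z.1 == 0) && (0 <= z.2).

Let ge0_0 : lexprod_ge0 0.
Proof. by rewrite /lexprod_ge0 eqxx lexx orbT. Qed.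

Let ge0_D (x y : lexprod G H) :
  lexprod_ge0 x -> lexprod_ge0 y -> lexprod_ge0 (x + y).
Proof.
have pD (a b : G) : 0 < a -> 0 <= b -> 0 < a + b.
  by move=> a0 b0; rewrite (lt_le_trans a0)// -[leLHS]addr0; exact: lg_leD2l.
rewrite /lexprod_ge0 /=.
case/orP=> [x1|/andP[/eqP x1 x2]]; case/orP=> [y1|/andP[/eqP y1 y2]].
- by rewrite pD// ltW.
- by rewrite y1 addr0 x1.
- by rewrite x1 add0r y1.
- by have := lg_leD x2 y2; rewrite addr0 x1 y1 addr0 eqxx => ->; rewrite orbT.
Qed.

Let ge0_N (x : lexprod G H) : lexprod_ge0 x -> lexprod_ge0 (- x) -> x = 0.
Proof.
have nN (K : poAbGroupType) (a : K) : 0 <= a -> 0 <= - a -> a = 0.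
  by move=> a0 /lg_leN2; rewrite opprK oppr0 => a0'; apply/le_anti/andP.
rewrite /lexprod_ge0 /=; case: x => a b /=.
case/orP=> [x1|/andP[/eqP x1 x2]]; case/orP=> [y1|/andP[/eqP y1 y2]].
- by have /eqP := nN _ _ (ltW x1) (ltW y1); rewrite gt_eqF.
- by move/eqP: y1; rewrite oppr_eq0 gt_eqF.
- by move: y1; rewrite x1 oppr0 ltxx.
- by rewrite x1 (nN _ _ x2 y2).
Qed.

HB.instance Definition _ := Order.Le_isPOrder.Build ring_display (lexprod G H)
  (@cone_le_refl _ _ ge0_0) (@cone_le_anti _ _ ge0_N) (@cone_le_trans _ _ ge0_D).

HB.instance Definition _ := isPOAbGroup.Build (lexprod G H)
  (@cone_leD2l _ lexprod_ge0).

Lemma lexprod_le0E (x : lexprod G H) : (0 <= x) = lexprod_ge0 x.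
Proof. exact: cone_le0. Qed.

Lemma lexprod_leE (x y : lexprod G H) :
  (x <= y) = (x.1 < y.1) || (x.1 == y.1) && (x.2 <= y.2).
Proof.
rewrite -(lg_subr_ge0 x) lexprod_le0E /lexprod_ge0 /= lg_subr_ge0 subr_eq0.
rewrite (eq_sym y.1); congr (_ || _).
by rewrite !lt_neqAle lg_subr_ge0 eq_sym subr_eq0 eq_sym.
Qed.

End LexProd.

Section LexProdLGroup.
Variables (G : totalAbGroupType) (H : abLGroupType).
Implicit Types x y z : lexprod G H.

Definition lexprod_meet x y : lexprod G H :=
  if x.1 < y.1 then x else if y.1 < x.1 then y else (x.1, lg_meet x.2 y.2).

Definition lexprod_join x y : lexprod G H :=
  if x.1 < y.1 then y else if y.1 < x.1 then x else (x.1, lg_join x.2 y.2).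

Let trichotomy (a b : G) : [\/ a < b, b < a | a = b].
Proof.
have [->|ab] := eqVneq a b; first by constructor 3.
have /orP[h|h] := lg_le_total a b; [constructor 1|constructor 2].
  by rewrite lt_neqAle ab.
by rewrite lt_neqAle eq_sym ab.
Qed.

Let lexI x y z : (x <= lexprod_meet y z) = (x <= y) && (x <= z).
Proof.
have lt_le (u v : lexprod G H) : u.1 < v.1 -> u <= v.
  by move=> uv; rewrite lexprod_leE uv.
rewrite /lexprod_meet; have [yz|zy|yz] := trichotomy y.1 z.1.
- rewrite yz; have [xy|//] := boolP (x <= y).
  by rewrite (le_trans xy)// lt_le.
- rewrite zy (lt_gtF zy); have [xz|] := boolP (x <= z); last by rewrite andbF.
  by rewrite (le_trans xz)// lt_le.
- rewrite yz ltxx !lexprod_leE /= yz lg_lexI.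
  by have [->|] := eqVneq x.1 z.1; rewrite ?ltxx//= ?orbF ?andbb.
Qed.

Let leUx x y z : (lexprod_join x y <= z) = (x <= z) && (y <= z).
Proof.
have lt_le (u v : lexprod G H) : u.1 < v.1 -> u <= v.
  by move=> uv; rewrite lexprod_leE uv.
rewrite /lexprod_join; have [xy|yx|xy] := trichotomy x.1 y.1.
- rewrite xy; have [yz|] := boolP (y <= z); last by rewrite andbF.
  by rewrite (le_trans _ yz)// lt_le.
- rewrite yx (lt_gtF yx); have [xz|//] := boolP (x <= z).
  by rewrite (le_trans _ xz)// lt_le.
- rewrite xy ltxx !lexprod_leE /= xy lg_leUx.
  by have [->|] := eqVneq y.1 z.1; rewrite ?ltxx//= ?orbF ?andbb.
Qed.

HB.instance Definition _ := POAbGroup_isLGroup.Build (lexprod G H) lexI leUx.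

End LexProdLGroup.

Definition lexG (d : Order.disp_t) (L : orderType d) (F : abLGroupType) :
  abLGroupType := lexprod (lexZ L) F.

Definition free_on_two_nonneg (F : abLGroupType) (a b : F) : Prop :=
  [/\ 0 <= a, 0 <= b &
      forall (H : abLGroupType) (x y : H), 0 <= x -> 0 <= y ->
        exists! f : F -> H, [/\ lgroup_hom f, f a = x & f b = y]].

(* An uncountable well-ordered chain all of whose proper initial segments are
   countable, i.e. a chain whose order type is the least uncountable ordinal. *)
Definition is_omega1 (d : Order.disp_t) (W : orderType d) : Prop :=
  [/\ wochoice.well_order (<=%O : rel W), ~ countable [set: W] &
      forall x : W, countable [set y : W | (y < x)%O]].

Module FreeOnTwoNonneg.

Inductive term : Type :=
  | gen_a | gen_b | zero | opp of term | add of term & term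
  | meet of term & term | join of term & term.

HB.instance Definition _ := gen_eqMixin term.
HB.instance Definition _ := gen_choiceMixin term.

Fixpoint eval (H : abLGroupType) (x y : H) (t : term) : H :=
  match t with
  | gen_a => x
  | gen_b => y
  | zero => 0
  | opp t => - eval x y t
  | add t u => eval x y t + eval x y u
  | meet t u => lg_meet (eval x y t) (eval x y u)
  | join t u => lg_join (eval x y t) (eval x y u)
  end.

Definition equiv (t u : term) : bool :=
  `[< forall (H : abLGroupType) (x y : H), 0 <= x -> 0 <= y ->
        eval x y t = eval x y u >].

Lemma equiv_refl : reflexive equiv.
Proof. by move=> t; apply/asboolP. Qed.

Lemma equiv_sym : symmetric equiv.
Proof.
by move=> t u; apply/asboolP/asboolP => h H x y x0 y0; rewrite (h H x y).
Qed.

Lemma equiv_trans : transitive equiv.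
Proof.
move=> u t v /asboolP tu /asboolP uv; apply/asboolP => H x y x0 y0.
by rewrite (tu H x y) ?(uv H x y).
Qed.

Canonical equiv_equiv := EquivRel equiv equiv_refl equiv_sym equiv_trans.

Local Open Scope quotient_scope.

Definition F : Type := {eq_quot equiv}.
HB.instance Definition _ := Choice.on F.
HB.instance Definition _ := EqQuotient.on F.

Definition mk (t : term) : F := \pi_F t.

Definition ev (H : abLGroupType) (x y : H) (p : F) : H := eval x y (repr p).

Lemma ev_mk (H : abLGroupType) (x y : H) t :
  0 <= x -> 0 <= y -> ev x y (mk t) = eval x y t.
Proof.
move=> x0 y0; rewrite /ev /mk; have : equiv (repr (\pi_F t)) t.
  by apply/eqmodP; rewrite reprK.
by move=> /asboolP; exact.
Qed.

Lemma F_ext (p q : F) :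
  (forall (H : abLGroupType) (x y : H), 0 <= x -> 0 <= y ->
     ev x y p = ev x y q) -> p = q.
Proof.
move=> h; rewrite -[p]reprK -[q]reprK; apply/eqmodP/asboolP => H x y x0 y0.
exact: h.
Qed.

Definition addF (p q : F) : F := mk (add (repr p) (repr q)).
Definition oppF (p : F) : F := mk (opp (repr p)).
Definition meetF (p q : F) : F := mk (meet (repr p) (repr q)).
Definition joinF (p q : F) : F := mk (join (repr p) (repr q)).

Lemma evE (H : abLGroupType) (x y : H) p : eval x y (repr p) = ev x y p.
Proof. by []. Qed.

Lemma addFA : associative addF.
Proof.
by move=> p q r; apply: F_ext => H x y x0 y0; rewrite !ev_mk//= !evE !ev_mk//= !evE addrA.
Qed.

Lemma addFC : commutative addF.
Proof. by move=> p q; apply: F_ext => H x y x0 y0; rewrite !ev_mk//= addrC. Qed.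

Lemma add0F : left_id (mk zero) addF.
Proof.
by move=> p; apply: F_ext => H x y x0 y0; rewrite ev_mk//= !evE ev_mk//= add0r.
Qed.

Lemma addNF : left_inverse (mk zero) oppF addF.
Proof.
by move=> p; apply: F_ext => H x y x0 y0; rewrite !ev_mk//= !evE ev_mk//= addNr.
Qed.

HB.instance Definition _ := GRing.isZmodule.Build F addFA addFC add0F addNF.

Definition leF (p q : F) : bool :=
  `[< forall (H : abLGroupType) (x y : H), 0 <= x -> 0 <= y ->
        ev x y p <= ev x y q >].

Lemma leF_refl : reflexive leF.
Proof. by move=> p; apply/asboolP. Qed.

Lemma leF_anti : antisymmetric leF.
Proof.
move=> p q /andP[/asboolP pq /asboolP qp]; apply: F_ext => H x y x0 y0.
by apply/le_anti; rewrite pq ?qp.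
Qed.

Lemma leF_trans : transitive leF.
Proof.
move=> q p r /asboolP pq /asboolP qr; apply/asboolP => H x y x0 y0.
by rewrite (le_trans (pq _ _ _ x0 y0))// qr.
Qed.

HB.instance Definition _ :=
  Order.Le_isPOrder.Build ring_display F leF_refl leF_anti leF_trans.

Lemma leFP (p q : F) :
  reflect (forall (H : abLGroupType) (x y : H), 0 <= x -> 0 <= y ->
    ev x y p <= ev x y q) (p <= q).
Proof. exact: asboolP. Qed.

Lemma evD (H : abLGroupType) (x y : H) (p q : F) :
  0 <= x -> 0 <= y -> ev x y (p + q) = ev x y p + ev x y q.
Proof. exact: ev_mk. Qed.

Lemma ev_meet (H : abLGroupType) (x y : H) (p q : F) :
  0 <= x -> 0 <= y -> ev x y (meetF p q) = lg_meet (ev x y p) (ev x y q).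
Proof. exact: ev_mk. Qed.

Lemma ev_join (H : abLGroupType) (x y : H) (p q : F) :
  0 <= x -> 0 <= y -> ev x y (joinF p q) = lg_join (ev x y p) (ev x y q).
Proof. exact: ev_mk. Qed.

Lemma leF_D2l (p q r : F) : p <= q -> r + p <= r + q.
Proof.
move=> /leFP pq; apply/leFP => H x y x0 y0.
by rewrite !evD//; apply: lg_leD2l; exact: pq.
Qed.

HB.instance Definition _ := isPOAbGroup.Build F leF_D2l.

Lemma lexIF (p q r : F) : (p <= meetF q r) = (p <= q) && (p <= r).
Proof.
apply/idP/andP => [/leFP h|[/leFP pq /leFP pr]].
  by split; apply/leFP => H x y x0 y0; have := h _ _ _ x0 y0;
    rewrite ev_meet// lg_lexI => /andP[].
by apply/leFP => H x y x0 y0; rewrite ev_meet// lg_lexI pq ?pr.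
Qed.

Lemma leUxF (p q r : F) : (joinF p q <= r) = (p <= r) && (q <= r).
Proof.
apply/idP/andP => [/leFP h|[/leFP pq /leFP pr]].
  by split; apply/leFP => H x y x0 y0; have := h _ _ _ x0 y0;
    rewrite ev_join// lg_leUx => /andP[].
by apply/leFP => H x y x0 y0; rewrite ev_join// lg_leUx pq ?pr.
Qed.

HB.instance Definition _ := POAbGroup_isLGroup.Build F lexIF leUxF.

Lemma exists_free :
  exists (F : abLGroupType) (a b : F), free_on_two_nonneg a b.
Proof.
pose A : abLGroupType := F.
pose a : A := mk gen_a.
pose b : A := mk gen_b.
have ev0 (H : abLGroupType) (x y : H) : 0 <= x -> 0 <= y ->
    ev x y (0 : A) = 0.
  by move=> x0 y0; exact: ev_mk.
exists A, a, b; split.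
- apply/leFP => H x y x0 y0.
  by rewrite ev0// ev_mk.
- apply/leFP => H x y x0 y0.
  by rewrite ev0// ev_mk.
move=> H x y x0 y0; exists (ev x y); split.
  split; [split => p q| |].
  + exact: evD.
  + exact: ev_meet.
  + exact: ev_join.
  + exact: ev_mk.
  + exact: ev_mk.
move=> f [[fD fI fU] fa fb]; apply/funext => p.
have f0 : f 0 = 0 by apply: (addrI (f 0)); rewrite -fD !addr0.
have fN q : f (- q) = - f q by apply: (addrI (f q)); rewrite -fD !subrr.
have mkP t : mk (repr (mk t)) =
    mk t by exact: reprK.
have mk2 (op : term -> term ->
      term)
    (opH : forall K : abLGroupType, K -> K -> K) t u :
    (forall (K : abLGroupType) (x y : K) t u, eval x y (op t u)
       = opH K (eval x y t) (eval x y u)) ->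
    mk (op t u) =
    mk (op (repr (mk t))
                           (repr (mk u))).
  move=> opE; apply: F_ext => K z w z0 w0.
  rewrite !ev_mk// !opE.
  by rewrite !evE !ev_mk.
suff {p} h t : eval x y t = f (mk t).
  by rewrite /ev h; congr f; exact: reprK.
elim: t => [||||t IHt u IHu|t IHt u IHu|t IHt u IHu] //=.
- move=> t ->; rewrite -fN; congr f.
  apply: F_ext => K z w z0 w0.
  by rewrite !ev_mk//= evE
    ev_mk.
- rewrite IHt IHu -fD; congr f; apply/esym.
  exact: (mk2 add (fun K => +%R)).
- rewrite IHt IHu -fI; congr f; apply/esym.
  exact: (mk2 meet (fun K => @lg_meet K)).
- rewrite IHt IHu -fU; congr f; apply/esym.
  exact: (mk2 join (fun K => @lg_join K)).
Qed.

End FreeOnTwoNonneg.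

Lemma free_on_two_nonneg_exists :
  exists (F : abLGroupType) (a b : F), free_on_two_nonneg a b.
Proof. exact: FreeOnTwoNonneg.exists_free. Qed.

Module Omega1.

Definition R : rel (nat -> bool) :=
  sval (wochoice.well_ordering_principle (nat -> bool)).

Lemma R_wo : wochoice.well_order R.
Proof. exact: svalP. Qed.

Lemma R_min (A : set (nat -> bool)) : A !=set0 ->
  exists2 m, A m & forall x, A x -> R m x.
Proof.
move=> [x Ax]; have [|m [[mA hm] _]] := R_wo (A := [pred x | `[< A x >]]).
  by exists x; apply/asboolP.
exists m; first exact/asboolP.
by move=> y Ay; apply: hm; apply/asboolP.
Qed.

Lemma R_total : total R.
Proof.
move=> x y; have [|m] := @R_min [set x; y]; first by exists x; left.
by move=> [->|->] h; [rewrite h//; right|rewrite [X in _ || X]h ?orbT//; left].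
Qed.

Lemma R_refl : reflexive R.
Proof. by move=> x; have := R_total x x; rewrite orbb. Qed.

Lemma R_anti : antisymmetric R.
Proof.
move=> x y /andP[xy yx].
have [|m [_ mu]] := R_wo (A := pred2 x y); first by exists x; exact/orP/or_introl.
have <- : m = x.
  by apply: mu; split=> [|z /orP[]/eqP ->]; rewrite ?R_refl// inE eqxx.
by apply: mu; split=> [|z /orP[]/eqP ->]; rewrite ?R_refl// inE eqxx orbT.
Qed.

Lemma R_trans : transitive R.
Proof.
move=> y x z xy yz; have [|m] := @R_min [set x; y; z].
  by exists x; left; left.
case=> [[->|->]|->] h; first by apply: h; right.
- have yx : R y x by apply: h; left; left.
  by rewrite (@R_anti x y) ?xy ?yx.
- have zy : R z y by apply: h; left; right.
  by rewrite -(@R_anti y z) ?yz ?zy.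
Qed.

Lemma cantor_uncountable : ~ countable [set: nat -> bool].
Proof.
move=> /countable_injP[f finj].
have finj' : injective f by move=> x y; apply: finj; rewrite inE.
pose D : nat -> bool := fun n => `[< exists2 g, f g = n & g n = false >].
have [Dt|Df] := boolP (D (f D)).
  by move/asboolP: (Dt) => [g /finj' ->]; rewrite Dt.
by move/asboolP: (Df); apply; exists D => //; apply/negbTE.
Qed.

Definition carrier : Type :=
  {x : nat -> bool | `[< countable [set y | R y x /\ y <> x] >]}.

HB.instance Definition _ := SubChoice.on carrier.

Definition le (x y : carrier) : bool := R (val x) (val y).

Lemma le_refl : reflexive le. Proof. by move=> x; exact: R_refl. Qed.
Lemma le_anti : antisymmetric le.
Proof. by move=> x y /R_anti; exact: val_inj. Qed.
Lemma le_trans : transitive le. Proof. by move=> x y z; exact: R_trans. Qed.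
Lemma le_total : total le. Proof. by move=> x y; exact: R_total. Qed.

HB.instance Definition _ :=
  Order.Le_isPOrder.Build (Order.Disp tt tt) carrier le_refl le_anti le_trans.
HB.instance Definition _ := Order.POrder_isTotal.Build (Order.Disp tt tt) carrier le_total.

Lemma carrierP : is_omega1 carrier.
Proof.
have ini (x : carrier) : countable [set y | R y (val x) /\ y <> val x].
  by have := valP x; rewrite /= => /asboolP.
split.
- move=> A [a Aa]; have [|m] := @R_min [set x | (exists2 c, c \in A & val c = x)].
    by exists (val a), a.
  move=> [c Ac <-] h; exists c; split; first by split=> // x Ax; apply: h; exists x.
  move=> c' [Ac' h']; apply/le_anti/andP; split; last exact: h'.
  by apply: h; exists c'.
- move=> cW; pose W : set (nat -> bool) :=
    fun x => `[< countable [set y | R y x /\ y <> x] >].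
  have cW' : countable W.
    apply: sub_countable cW; apply: (@card_le_trans _ _ _ (val @` [set: carrier])).
      by apply: subset_card_le => x Wx; exists (Sub x Wx : carrier).
    exact: card_image_le.
  have [WT|] := pselect (W = setT).
    by apply: cantor_uncountable; rewrite -WT.
  move=> nWT; have [|m nm hm] := @R_min (~` W).
    apply/set0P/eqP => W0; apply: nWT.
    by rewrite -[W]setCK W0 setC0.
  apply: nm; apply/asboolP; apply: sub_countable cW'.
  apply: subset_card_le => y [ym ney].
  apply: contrapT => nWy; apply: ney; apply: R_anti.
  by rewrite ym hm.
- move=> x; apply/countable_injP.
  have /countable_injP[f finj] := ini x.
  exists (f \o val) => y z /set_mem /= yx /set_mem /= zx e; apply: val_inj.
  apply: finj => //; apply/mem_set => /=.
  + split; first exact: ltW yx.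
    by move=> /val_inj e'; move: yx; rewrite e' ltxx.
  + split; first exact: ltW zx.
    by move=> /val_inj e'; move: zx; rewrite e' ltxx.
Qed.

Lemma exists_omega1 :
  exists (d : Order.disp_t) (W : orderType d), is_omega1 W.
Proof. by exists _, carrier; exact: carrierP. Qed.

End Omega1.

Lemma omega1_exists :
  exists (d : Order.disp_t) (W : orderType d), is_omega1 W.
Proof. exact: Omega1.exists_omega1. Qed.

(* Main.v *)
Require Import Defs.
From HB Require Import structures.
From mathcomp Require Import all_boot all_order all_algebra.
From mathcomp.multinomials Require Import freeg.
From mathcomp Require Import all_classical topology.
From mathcomp Require Import zify ring.

(* Suppose X, the l-spectrum of G, embeds spectrally into a Brumfiel spectrum.
   Choose elements al, be, c_xi >= 0 of the ring whose cozero sets cut out in X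
   the compact open sets of a, b and of the generators indexed by xi.  Every
   nonzero (p, q) in N^2 gives a prime "ray" P_(p,q) of G, the kernel on F of
   a |-> p, b |-> q.  On a given ray, al = c_xi be modulo the prime can hold for
   at most one xi, because two different c_xi are separated by a prime above the
   ray.  There are countably many rays and uncountably many xi, so for some xi
   each ray lies in the cozero set of exactly one of the positive and negative
   parts of al - c_xi be.  In X these cozero sets are compact open and
   contained in those of a and b, hence cut out on rays by finitely many
   lattice-group terms with integer coefficients.  One of them contains the ray
   (1, 0) and the other the ray (0, 1); refining a cone on which they differ
   until all the terms are linear on it, the sum of its two edges lies in both,
   which is absurd.  For the real spectrum of R the same argument applies with
   lattice-ring terms over R in place of elements of an f-ring. *)

Set Implicit Arguments.
Unset Strict Implicit.
Unset Printing Implicit Defensive.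
Import Order.TTheory GRing.Theory Num.Theory.
Local Open Scope classical_set_scope.
Local Open Scope ring_scope.

(** * Compact open sets, spectral embeddings and ultrafilters *)

(** If no member covers [K], directedness makes the sets [K] minus [D i] a filter base; a cluster
    point of it in [K] would lie in some open [D i], which misses a set of the filter. *)
Lemma compact_sub_directed (X : topologicalType) (K : set X) (I : Type)
    (B : set I) (D : I -> set X) :
  compact K -> B !=set0 ->
  (forall i j, B i -> B j -> exists2 k, B k & D i `|` D j `<=` D k) ->
  (forall i, B i -> open (D i)) -> K `<=` \bigcup_(i in B) D i ->
  exists2 i, B i & K `<=` D i.
Proof.
move=> cK [i0 Bi0] dirB oD KD; apply: contrapT => nK.
have ex i : B i -> exists x, K x /\ ~ D i x.
  move=> Bi; apply: contra_notP nK => nx; exists i => // x Kx.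
  by apply: contra_notP nx => nDx; exists x.
pose Fi := filter_from B (fun i => K `&` ~` D i).
have Fi_proper : ProperFilter Fi.
  apply: filter_from_proper => [|i /ex[x]]; last by exists x.
  apply: filter_from_filter; first by exists i0.
  move=> i j Bi Bj; have [k Bk Dk] := dirB i j Bi Bj.
  by exists k => // x [Kx nDx]; split; split=> // Dx; apply: nDx; apply: Dk;
    [left|right].
have [|p [Kp clp]] := cK Fi Fi_proper; first by exists i0 => // x [].
have [i Bi Dip] := KD _ Kp.
have [|//|x [[_ nDx] Dx]] := clp (K `&` ~` D i) (D i).
- by exists i.
- by apply: open_nbhs_nbhs; split=> //; exact: oD.
- exact: nDx.
Qed.

(** The [D t] inside [U] are directed, being closed under unions, so compactness makes one of them
    equal to [U]. *)
Lemma compact_open_basisP (X : topologicalType) (T : Type) (D : T -> set X) :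
  (forall t, open (D t)) -> (exists t, D t = set0) ->
  (forall s t, exists r, D r = D s `|` D t) ->
  (forall U x, open U -> U x -> exists2 t, D t x & D t `<=` U) ->
  forall U, Defs.compact_open U -> exists t, D t = U.
Proof.
move=> oD [t0 Dt0] DU basD U [cU oU].
have [|s t sU tU||x Ux|t tU Ut] :=
    @compact_sub_directed _ U _ [set t | D t `<=` U] D cU.
- by exists t0; rewrite /= Dt0.
- by have [r rE] := DU s t; exists r; rewrite /= rE// => x [/sU|/tU].
- by move=> *; exact: oD.
- by have [t tx tU] := basD U x oU Ux; exists t.
- by exists t; apply/seteqP; split.
Qed.

(** Trades the subspace and the homeomorphism for one map into [Y], so that later arguments only
    take preimages. *)
Lemma embeds_as_spectral_subspaceP (X Y : topologicalType) :
  embeds_as_spectral_subspace X Y -> exists e : X -> Y,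
    (forall V, Defs.compact_open V -> Defs.compact_open (e @^-1` V)) /\
    (forall U, open U <-> exists2 V, open V & U = e @^-1` V).
Proof.
move=> [Z [[_ _ sp] [f [g [fK gK cf cg]]]]]; exists (set_val \o f); split.
  move=> V /sp [cV oV]; split; last exact: ((continuousP f).1 cf _ oV).
  have -> : (set_val \o f) @^-1` V = g @` (set_val @^-1` V : set (set_type Z)).
    apply/seteqP; split=> [x /= Vx|_ [z Vz <-]].
      by exists (f x).
    by rewrite /= gK.
  apply: continuous_compact => //; apply: continuous_subspaceT => ?; exact: cg.
move=> U; split.
  move=> oU; have : open (g @^-1` U) by exact: ((continuousP g).1 cg _ oU).
  move=> [V oV gV]; exists V => //; apply/seteqP; split=> x /=.
    move=> Ux; have : (g @^-1` U) (f x) by rewrite /= fK.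
    by rewrite -gV.
  by rewrite -[V _]/((set_val @^-1` V) (f x)) gV /= fK.
move=> [V oV ->]; rewrite comp_preimage.
apply: ((continuousP f).1 cf); by exists V.
Qed.

Lemma ultra_setU T (F : set_system T) (A B : set T) : UltraFilter F ->
  F (A `|` B) -> F A \/ F B.
Proof.
move=> UF FAB; have [?|nA] := in_ultra_setVsetC A UF; first by left.
right; apply: filterS (filterI FAB nA) => x [] [] //.
Qed.

Lemma ultra_not T (F : set_system T) (A : set T) : UltraFilter F ->
  ~ F A -> F (~` A).
Proof. by move=> UF nA; have [] := in_ultra_setVsetC A UF. Qed.

(** * The topology of the l-spectrum *)

Section LSpectrum.
Variable G : abLGroupType.
Implicit Types (P Q : lspectrum G) (g : G).

Definition lspectrum_D g : set (lspectrum G) := [set P | ~ lspectrum_set P g].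

Lemma open_lspectrum_D g : open (lspectrum_D g).
Proof.
exists [set g] => //; apply/seteqP; split=> P /= nP; last by move/(_ g erefl).
by move=> Pg; apply: nP => _ ->.
Qed.

Lemma open_lspectrumE (U : set (lspectrum G)) : open U ->
  forall P, U P -> exists2 g, lspectrum_D g P & lspectrum_D g `<=` U.
Proof.
move=> [I _ <-] P /= nP.
have [g Ig nPg] : exists2 g, I g & ~ lspectrum_set P g.
  apply: contra_notP nP => nP g Ig; apply: contra_notP nP => nPg.
  by exists g.
by exists g => // Q nQ IQ; apply: nQ; exact: IQ.
Qed.

(** Applied to preimages of open sets, this makes a spectral embedding preserve inclusion of
    points. *)
Lemma open_lspectrum_generization (U : set (lspectrum G)) P Q : open U ->
  P `<=` Q -> U Q -> U P.
Proof.
by move=> oU PQ /(open_lspectrumE oU)[g nQ]; apply=> /PQ.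
Qed.

(** An ultrafilter converges to the set of elements that lie in almost every prime; each axiom of a
    prime passes to this limit, the disjunction because the filter is ultra. *)
Lemma compact_lspectrum_D g : compact (lspectrum_D g).
Proof.
rewrite compact_ultra => F UF Fg.
pose S := [set x | F [set P | lspectrum_set P x]].
have nSg : ~ S g.
  by move=> Sg; have [P []] := filter_ex (filterI Fg Sg).
have Sp : prime_lideal S.
  split; last 2 first.
  - by move=> ST; apply: nSg; rewrite ST.
  - move=> x y Sxy; apply: ultra_setU; apply: filterS Sxy => P /=.
    have [_ _ PI] := lspectrum_prime P; exact: PI.
  split; [split| |].
  - apply: filterS filterT => P _; by have [[[]]] := lspectrum_prime P.
  - move=> x y Sx Sy; apply: filterS (filterI Sx Sy) => P [/= Px Py].
    have [[[_ PD _] _ _] _ _] := lspectrum_prime P; exact: PD.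
  - move=> x; apply: filterS => P /=.
    have [[[_ _ PN] _ _] _ _] := lspectrum_prime P; exact: PN.
  - move=> x y Sx Sy; split; apply: filterS (filterI Sx Sy) => P [/= Px Py];
      by have [[_ PL _] _ _] := lspectrum_prime P; have [] := PL _ _ Px Py.
  - move=> x y z Sx Sz xy yz; apply: filterS (filterI Sx Sz) => P [/= Px Pz].
    have [[_ _ Pc] _ _] := lspectrum_prime P; exact: (Pc x y z).
exists (LSpectrum Sp); split=> //= V; rewrite nbhsE => -[U [oU UP] UV].
have [h nSh hU] := open_lspectrumE oU UP.
apply: filterS (subset_trans hU UV) _; exact: ultra_not nSh.
Qed.

Lemma compact_open_lspectrumP (U : set (lspectrum G)) : Defs.compact_open U ->
  exists s : seq G, U = [set P | exists2 g, g \in s & lspectrum_D g P].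
Proof.
(* Lists supply the empty set and unions without any lattice computation. *)
pose D (s : seq G) := [set P | exists2 g, g \in s & lspectrum_D g P].
have oD s : open (D s).
  have -> : D s = \bigcup_(g in [set g | g \in s]) lspectrum_D g by [].
  by apply: bigcup_open => g _; exact: open_lspectrum_D.
move=> /(compact_open_basisP oD)[||V P oV VP|s <-]; last by exists s.
- by exists [::]; apply/seteqP; split=> // P [].
- move=> s t; exists (s ++ t); apply/seteqP; split=> P.
    by move=> [g]; rewrite mem_cat => /orP[] gs gP; [left|right]; exists g.
  by move=> [|] [g gs gP]; exists g => //; rewrite mem_cat gs ?orbT.
- have [g gP gV] := open_lspectrumE oV VP; exists [:: g].
    by exists g => //; rewrite inE.
  by move=> Q [h]; rewrite inE => /eqP ->; exact: gV.
Qed.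

End LSpectrum.

(** * Piecewise linear terms on the quadrant *)

(** The integers become an l-group so that [eval] applies to integer vectors. *)
Lemma int_leD2l (x y z : int) : x <= y -> z + x <= z + y.
Proof. by rewrite lerD2l. Qed.

HB.instance Definition _ := isPOAbGroup.Build int int_leD2l.

Lemma int_lexI (x y z : int) : (x <= Num.min y z) = (x <= y) && (x <= z).
Proof. exact: le_min. Qed.

Lemma int_leUx (x y z : int) : (Num.max x y <= z) = (x <= z) && (y <= z).
Proof. exact: ge_max. Qed.

HB.instance Definition _ := POAbGroup_isLGroup.Build int int_lexI int_leUx.

Lemma int_meetE (x y : int) : lg_meet x y = Num.min x y. Proof. by []. Qed.
Lemma int_joinE (x y : int) : lg_join x y = Num.max x y. Proof. by []. Qed.

Import FreeOnTwoNonneg.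

Definition evalZ (v : int * int) (t : term) : int := eval v.1 v.2 t.

Definition combZ (v w : int * int) (i j : nat) : int * int :=
  (v.1 *+ i + w.1 *+ j, v.2 *+ i + w.2 *+ j).

(** Linearity on the cone with edges [v] and [w], tested on natural combinations only so that
    everything stays integral. *)
Definition linear_between (t : term) (v w : int * int) : Prop :=
  forall i j, evalZ (combZ v w i j) t = evalZ v t *+ i + evalZ w t *+ j.

Definition nonneg_vec (v : int * int) : Prop :=
  [/\ 0 <= v.1, 0 <= v.2 & v <> 0].

(* No topology is needed to locate the boundary of [U]: it is trapped between
   two vectors, and splitting a cone always leaves a half that still traps it. *)
Definition separates (U : set (int * int)) (v w : int * int) : Prop :=
  [/\ nonneg_vec v, nonneg_vec w, U v & ~ U w].

Definition subcone (v' w' v w : int * int) : Prop :=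
  (exists i j, v' = combZ v w i j) /\ (exists i j, w' = combZ v w i j).

Lemma combZ_comb v w i j k l m n :
  combZ (combZ v w i j) (combZ v w k l) m n =
  combZ v w (i * m + k * n) (j * m + l * n).
Proof. by rewrite /combZ /=; congr pair; lia. Qed.

Lemma subcone_refl v w : subcone v w v w.
Proof.
by split; [exists 1%N, 0%N|exists 0%N, 1%N]; rewrite /combZ /= ?mulr1n ?mulr0n
  ?addr0 ?add0r; [case: v|case: w].
Qed.

Lemma subcone_trans v1 w1 v2 w2 v3 w3 :
  subcone v1 w1 v2 w2 -> subcone v2 w2 v3 w3 -> subcone v1 w1 v3 w3.
Proof.
move=> [[i [j ->]] [k [l ->]]] [[i' [j' ->]] [k' [l' ->]]].
by split; rewrite combZ_comb; do 2 eexists.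
Qed.

Lemma linear_subcone t v' w' v w :
  subcone v' w' v w -> linear_between t v w -> linear_between t v' w'.
Proof.
move=> [[i [j ->]] [k [l ->]]] lt m n.
by rewrite combZ_comb !lt; lia.
Qed.

Lemma separates_insert U v w i j : separates U v w -> (0 < i)%N -> (0 < j)%N ->
  exists v' w', [/\ separates U v' w', subcone v' w' v w &
    v' = combZ v w i j \/ w' = combZ v w i j].
Proof.
move=> [v0 w0 Uv nUw] i0 j0; pose z := combZ v w i j.
have z0 : nonneg_vec z.
  move: v0 w0; rewrite /z /combZ; case: v {Uv z} => v1 v2; case: w {nUw} => w1 w2.
  move=> [/= v1_ge v2_ge vN] [/= w1_ge w2_ge _]; split=> /=; [lia|lia|].
  by move=> [e1 e2]; apply: vN; congr pair; nia.
have sz : exists k l, z = combZ v w k l by exists i, j.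
have [sv sw] := subcone_refl v w.
have [Uz|nUz] := pselect (U z).
  by exists z, w; split; [split| |left].
by exists v, z; split; [split| |right].
Qed.

(** Induction on the term. Refinement preserves linearity, and a meet or join of two linear terms is
    linear once their difference has the same weak sign at both edges. *)
Lemma separates_linear U t v w : separates U v w ->
  exists v' w', [/\ separates U v' w', subcone v' w' v w &
    linear_between t v' w'].
Proof.
have refine t1 t2 v1 w1 :
    (forall v w, separates U v w -> exists v' w',
      [/\ separates U v' w', subcone v' w' v w & linear_between t1 v' w']) ->
    (forall v w, separates U v w -> exists v' w',
      [/\ separates U v' w', subcone v' w' v w & linear_between t2 v' w']) ->
    separates U v1 w1 -> exists v' w',
      [/\ separates U v' w', subcone v' w' v1 w1,
          linear_between t1 v' w' & linear_between t2 v' w'].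
  move=> IH1 IH2 /IH1[v2 [w2 [/IH2[v3 [w3 [s3 c3 l3]]] c2 l2]]].
  exists v3, w3; split=> //; first exact: subcone_trans c2.
  exact: linear_subcone l2.
(* Where [t1 - t2] changes sign, the cone is split along its zero ray. *)
have signs t1 t2 v1 w1 : separates U v1 w1 ->
    linear_between t1 v1 w1 -> linear_between t2 v1 w1 ->
    exists v' w', [/\ separates U v' w', subcone v' w' v1 w1 &
      evalZ v' t1 <= evalZ v' t2 /\ evalZ w' t1 <= evalZ w' t2 \/
      evalZ v' t2 <= evalZ v' t1 /\ evalZ w' t2 <= evalZ w' t1].
  move=> s1 l1 l2; have sr := subcone_refl v1 w1.
  have cross : evalZ v1 t1 < evalZ v1 t2 /\ evalZ w1 t2 < evalZ w1 t1 \/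
      evalZ v1 t2 < evalZ v1 t1 /\ evalZ w1 t1 < evalZ w1 t2 ->
      exists v' w', [/\ separates U v' w', subcone v' w' v1 w1 &
      evalZ v' t1 <= evalZ v' t2 /\ evalZ w' t1 <= evalZ w' t2 \/
      evalZ v' t2 <= evalZ v' t1 /\ evalZ w' t2 <= evalZ w' t1].
    (* With these weights the two differences of opposite sign cancel, so [t1] and [t2] agree at the
       inserted vector. *)
    move=> sgn; have [||v' [w' [s' c' z]]] := @separates_insert U v1 w1
      `|evalZ w1 t1 - evalZ w1 t2|%N `|evalZ v1 t1 - evalZ v1 t2|%N s1;
      [lia|lia|].
    have [v'E|w'E] := z; [have [_ [k [l w'E]]] := c'|have [[k [l v'E]] _] := c'];
      by exists v', w'; split=> //; rewrite v'E w'E !l1 !l2; nia.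
  have [d1|d1|d1] := ltgtP (evalZ v1 t1) (evalZ v1 t2);
    have [d2|d2|d2] := ltgtP (evalZ w1 t1) (evalZ w1 t2);
    try by exists v1, w1; split=> //; lia.
  - by apply: cross; left.
  - by apply: cross; right.
elim: t v w => [|||t IH|t1 IH1 t2 IH2|t1 IH1 t2 IH2|t1 IH1 t2 IH2] v w s.
- exists v, w; split=> //; exact: subcone_refl.
- exists v, w; split=> //; exact: subcone_refl.
- exists v, w; split; [by []|exact: subcone_refl|].
  by move=> i j; rewrite /evalZ /= !mul0rn addr0.
- have [v' [w' [s' c' l']]] := IH v w s; exists v', w'; split=> // i j.
  by have := l' i j; rewrite /evalZ /= => ->; lia.
- have [v' [w' [s' c' l1 l2]]] := refine _ _ _ _ IH1 IH2 s.
  exists v', w'; split=> // i j; have := l1 i j; have := l2 i j.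
  by rewrite /evalZ /= => -> ->; lia.
- have [v1 [w1 [s1 c1 l1 l2]]] := refine _ _ _ _ IH1 IH2 s.
  have [v2 [w2 [s2 c2 sgn]]] := signs _ _ _ _ s1 l1 l2.
  exists v2, w2; split=> //; first exact: subcone_trans c1.
  move=> i j; have := linear_subcone c2 l1 i j; have := linear_subcone c2 l2 i j.
  by move: sgn; rewrite /evalZ /= !int_meetE => + -> ->; nia.
- have [v1 [w1 [s1 c1 l1 l2]]] := refine _ _ _ _ IH1 IH2 s.
  have [v2 [w2 [s2 c2 sgn]]] := signs _ _ _ _ s1 l1 l2.
  exists v2, w2; split=> //; first exact: subcone_trans c1.
  move=> i j; have := linear_subcone c2 l1 i j; have := linear_subcone c2 l2 i j.
  by move: sgn; rewrite /evalZ /= !int_joinE => + -> ->; nia.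
Qed.

Lemma separates_linear_seq U (ts : seq term) v w : separates U v w ->
  exists v' w', [/\ separates U v' w', subcone v' w' v w &
    forall t, t \in ts -> linear_between t v' w'].
Proof.
elim: ts v w => [|t ts IH] v w s.
  by exists v, w; split=> //; exact: subcone_refl.
have [v1 [w1 [s1 c1 l1]]] := separates_linear t s.
have [v2 [w2 [s2 c2 l2]]] := IH _ _ s1.
exists v2, w2; split=> //; first exact: subcone_trans c1.
move=> u; rewrite inE => /orP[/eqP ->|/l2//]; exact: linear_subcone l1.
Qed.

(* If the sets cut out by [ss] and by [ts] were complementary, refining until
   every term is linear would put [v + w] in both. *)
Lemma nonvanishing_overlap (ss ts : seq term) v0 w0 :
  nonneg_vec v0 -> nonneg_vec w0 ->
  (exists2 t, t \in ss & evalZ v0 t != 0) ->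
  (forall t, t \in ss -> evalZ w0 t = 0) ->
  (forall v, nonneg_vec v -> exists2 t, t \in ss ++ ts & evalZ v t != 0) ->
  exists v, [/\ nonneg_vec v, exists2 t, t \in ss & evalZ v t != 0 &
                exists2 t, t \in ts & evalZ v t != 0].
Proof.
move=> v0P w0P sv0 sw0 cover.
pose U : set (int * int) := [set v | exists2 t, t \in ss & evalZ v t != 0].
have [|v [w [[vP wP [s ss_s sv] nUw] _ lin]]] :=
    @separates_linear_seq U (ss ++ ts) v0 w0.
  by split=> // -[t /sw0 ->]; rewrite eqxx.
have sw : forall t, t \in ss -> evalZ w t = 0.
  by move=> t tss; apply: contra_notP nUw => /eqP nz; exists t.
have [t tts tw] : exists2 t, t \in ts & evalZ w t != 0.
  have [t + tw] := cover w wP; rewrite mem_cat => /orP[/sw t0|]; last by exists t.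
  by rewrite t0 eqxx in tw.
(* Either [v] already lies in both sets, or [s] lives only at [v] and [t] only at [w], and neither
   cancels on the sum. *)
have [[t' t'ts t'v]|ntv] := pselect (exists2 t, t \in ts & evalZ v t != 0).
  by exists v; split=> //; [exists s|exists t'].
have tv : evalZ v t = 0 by apply: contra_notP ntv => /eqP nz; exists t.
exists (combZ v w 1 1); split.
- move: vP wP; rewrite /combZ; case: (v) => v1 v2; case: (w) => w1 w2.
  move=> [/= v1_ge v2_ge vN] [/= w1_ge w2_ge _]; split=> /=; [lia|lia|].
  by move=> [e1 e2]; apply: vN; congr pair; lia.
- exists s => //; rewrite lin ?mem_cat ?ss_s//.
  by rewrite (sw _ ss_s) mul0rn addr0 mulr1n.
- exists t => //; rewrite lin ?mem_cat ?tts ?orbT//.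
  by rewrite tv mul0rn add0r mulr1n.
Qed.

(** * Prime ideals of the lexicographic product *)

(** Mapping [F] to the term model and choosing representatives gives one term per element that
    serves all vectors [v] at once, as refinement of cones requires. *)
Lemma free_to_terms (F : abLGroupType) (a b : F) : free_on_two_nonneg a b ->
  exists tau : F -> term, forall v : int * int, 0 <= v.1 -> 0 <= v.2 ->
    [/\ lgroup_hom (fun f => evalZ v (tau f)), evalZ v (tau a) = v.1 &
        evalZ v (tau b) = v.2].
Proof.
move=> [_ _ univ].
have [||phi [[[phiD phiI phiU] phia phib] _]] :=
    univ FreeOnTwoNonneg.F (mk gen_a) (mk gen_b).
- by apply/leFP => H x y x0 y0; rewrite (ev_mk zero)// ev_mk.
- by apply/leFP => H x y x0 y0; rewrite (ev_mk zero)// ev_mk.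
exists (fun f => generic_quotient.repr (phi f)) => v v1 v2.
rewrite /evalZ !evE phia phib !ev_mk//; split=> //; split=> f g.
- by rewrite !evE phiD evD.
- by rewrite !evE phiI (ev_meet _ _ v1 v2).
- by rewrite !evE phiU (ev_join _ _ v1 v2).
Qed.

Section LGroupHomInt.
Variables (F : abLGroupType) (h : F -> int).
Hypothesis h_hom : lgroup_hom h.

Lemma lgroup_hom0 : h 0 = 0.
Proof. by have [hD _ _] := h_hom; apply: (addrI (h 0)); rewrite -hD !addr0. Qed.

Lemma lgroup_homN x : h (- x) = - h x.
Proof.
have [hD _ _] := h_hom.
by apply: (addrI (h x)); rewrite -hD !subrr lgroup_hom0.
Qed.

Lemma lgroup_hom_le x y : x <= y -> h x <= h y.
Proof.
have [_ hI _] := h_hom => xy.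
have -> : x = lg_meet x y by apply/le_anti; rewrite lg_lexI lexx xy lg_leIl.
by rewrite hI lg_leIr.
Qed.

End LGroupHomInt.

Section LexGPrimes.
Variables (d : Order.disp_t) (L : orderType d) (F : abLGroupType).
Local Notation G := (lexG L F).
Implicit Types (g : G) (xi eta : L).

Lemma lexG_meet1 (x y : G) : (lg_meet x y).1 = x.1 \/ (lg_meet x y).1 = y.1.
Proof.
rewrite [lg_meet x y]/(lexprod_meet x y) /lexprod_meet.
by case: ifP => _; [left|case: ifP => _; [right|left]].
Qed.

Lemma lexG_join1 (x y : G) : (lg_join x y).1 = x.1 \/ (lg_join x y).1 = y.1.
Proof.
rewrite [lg_join x y]/(lexprod_join x y) /lexprod_join.
by case: ifP => _; [right|case: ifP => _; [left|left]].
Qed.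

Lemma lexG_le1 (x y : G) : x <= y -> x.1 <= y.1.
Proof. by rewrite lexprod_leE => /orP[/ltW|/andP[/eqP ->]]. Qed.

Definition ray_set (h : F -> int) : set G := [set g | g.1 = 0 /\ h g.2 = 0].

Lemma lexG_meetP (x y : G) :
  [\/ lg_meet x y = x, lg_meet x y = y |
      x.1 = y.1 /\ lg_meet x y = (x.1, lg_meet x.2 y.2)].
Proof.
rewrite [lg_meet x y]/(lexprod_meet x y) /lexprod_meet.
have [//|xy] := boolP (x.1 < y.1); first by constructor 1.
have [//|yx] := boolP (y.1 < x.1); first by constructor 2.
constructor 3; split=> //; apply/eqP/negPn/negP => nxy.
have /orP[le_xy|le_yx] := lg_le_total x.1 y.1.
  by rewrite lt_neqAle nxy le_xy in xy.
by rewrite lt_neqAle eq_sym nxy le_yx in yx.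
Qed.

Lemma lexG_joinP (x y : G) :
  [\/ lg_join x y = x, lg_join x y = y |
      lg_join x y = (x.1, lg_join x.2 y.2)].
Proof.
rewrite [lg_join x y]/(lexprod_join x y) /lexprod_join.
by case: ifP => _; [constructor 2|case: ifP => _; [constructor 1|constructor 3]].
Qed.

(** A meet is one of its arguments unless the first coordinates agree; in that case [h] sends it to
    a minimum of two integers, which is one of them. *)
Lemma ray_set_prime h : lgroup_hom h -> (exists f, h f <> 0) ->
  prime_lideal (ray_set h).
Proof.
move=> hh [f0 hf0]; have [hD hI hU] := hh; split; last 2 first.
- move=> RT; apply: hf0; have : ray_set h ((0, f0) : G) by rewrite RT.
  by case.
- move=> x y; have [->|->|[xy ->]] := lexG_meetP x y; [by left|by right|].
  rewrite /ray_set /= -xy hI int_meetE => -[x0].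
  by case: leP => _ h0; [left|right].
split; [split| |].
- by split=> //=; exact: lgroup_hom0.
- by move=> x y [x1 x2] [y1 y2]; split=> /=; rewrite ?x1 ?y1 ?addr0// hD x2 y2.
- move=> x [x1 x2]; split; rewrite /= ?x1 ?oppr0//.
  by rewrite lgroup_homN// x2 oppr0.
- move=> x y [x1 x2] [y1 y2]; split.
    have [->|->|[_ ->]] := lexG_meetP x y => //.
    by split; rewrite //= hI x2 y2.
  have [->|->|->] := lexG_joinP x y => //.
  by split; rewrite //= hU x2 y2.
- move=> x y z [x1 x2] [z1 z2] xy yz.
  have y1 : y.1 = 0.
    apply/le_anti/andP; split.
      by rewrite -z1; exact: lexG_le1.
    by rewrite -x1; exact: lexG_le1.
  move: xy yz; rewrite !lexprod_leE x1 y1 z1 ltxx eqxx /= => xy yz.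
  split=> //; apply/le_anti.
  by rewrite -{1}z2 -x2 !(lgroup_hom_le hh).
Qed.

(* [tail_set xi] is generated by [F] and the [c_eta] with [eta < xi]. *)
Definition tail_set xi : set G :=
  [set g | forall eta, (xi <= eta)%O -> coeff eta g.1 = 0].

Lemma tail_set_prime xi : prime_lideal (tail_set xi).
Proof.
split; last 2 first.
- move=> TT; have : tail_set xi ((<< xi >> : lexZ L, 0) : G) by rewrite TT.
  by move=> /(_ xi (lexx _)) /=; rewrite coeffU eqxx.
- by move=> x y; rewrite /tail_set /=; have [->|->] := lexG_meet1 x y;
    [left|right].
split; [split| |].
- by move=> eta _; rewrite coeff0.
- by move=> x y hx hy eta xe; rewrite coeffD hx// hy.
- by move=> x hx eta xe; rewrite coeffN hx// oppr0.
- by move=> x y hx hy; rewrite /tail_set /=;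
    have [->|->] := lexG_meet1 x y; have [->|->] := lexG_join1 x y.
move=> x y z hx hz /lexG_le1; rewrite -lg_subr_ge0 lexZ_le0E => xy.
move=> /lexG_le1; rewrite -lg_subr_ge0 lexZ_le0E => yz zeta xi_zeta.
apply: contrapT => ny.
(* The leading indices of [y - x] and [z - y] are at least [zeta], where [x] and [z] have zero
   coefficients. So [y] would have a positive leading coefficient at [eta] and a negative one at
   [mu]. *)
have [yx0|[eta eta_pos eta_top]] := (lexZ_ge0P _).1 xy.
  by apply: ny; rewrite -(hx _ xi_zeta); congr coeff; apply/subr0_eq.
have [zy0|[mu mu_pos mu_top]] := (lexZ_ge0P _).1 yz.
  by apply: ny; rewrite -(hz _ xi_zeta); congr coeff; apply/esym/subr0_eq.
have zeta_eta : (zeta <= eta)%O.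
  rewrite leNgt; apply/negP => /eta_top.
  by rewrite coeffB hx// subr0.
have zeta_mu : (zeta <= mu)%O.
  rewrite leNgt; apply/negP => /mu_top.
  by rewrite coeffB hz// sub0r => /eqP; rewrite oppr_eq0 => /eqP.
have xi_eta := le_trans xi_zeta zeta_eta; have xi_mu := le_trans xi_zeta zeta_mu.
rewrite coeffB hx// subr0 in eta_pos; rewrite coeffB hz// sub0r in mu_pos.
have [em|me|em] := ltgtP eta mu.
- by move: (eta_top _ em) mu_pos; rewrite coeffB hx// subr0 => ->; rewrite oppr0 ltxx.
- move: (mu_top _ me) eta_pos; rewrite coeffB hz// sub0r => /eqP.
  by rewrite oppr_eq0 => /eqP ->; rewrite ltxx.
- by move: mu_pos; rewrite -em oppr_gt0 => /(lt_trans eta_pos); rewrite ltxx.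
Qed.

Definition tail xi : lspectrum G := LSpectrum (tail_set_prime xi).

Definition gen xi : G := (<< xi >> : lexZ L, 0).

(** For [xi] below [eta], the tail at [eta] contains the generator at [xi] but not the one at [eta];
    this separates different generators above every ray. *)
Lemma tail_gen xi eta : lspectrum_set (tail xi) (gen eta) <-> (eta < xi)%O.
Proof.
split=> [h|ex zeta xz].
  rewrite ltNge; apply/negP => xe; have := h _ xe.
  by rewrite /= coeffU eqxx.
by rewrite /= coeffU mul1r lt_eqF// (lt_le_trans ex).
Qed.

Lemma tail_all (g : G) : (forall xi, lspectrum_set (tail xi) g) -> g.1 = 0.
Proof.
move=> h; apply/eqP/freeg_eqP => xi; rewrite coeff0.
exact: (h xi).
Qed.

Lemma tail_snd xi (f : F) : lspectrum_set (tail xi) ((0, f) : G).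
Proof. by move=> eta _; rewrite coeff0. Qed.

End LexGPrimes.

(* [D t] is the cozero set of [t]; [u al c be] and [v al c be] stand for the
   positive and negative parts of [|al| - |c| |be|]. *)
Lemma no_semialgebraic_parametrization (d : Order.disp_t) (L : orderType d)
    (F : abLGroupType) (a b : F) (T : Type)
    (D : T -> set (lspectrum (lexG L F))) (u v : T -> T -> T -> T) :
  ~ countable [set: L] -> free_on_two_nonneg a b ->
  (forall t, Defs.compact_open (D t)) ->
  (forall U, Defs.compact_open U -> exists t, D t = U) ->
  (forall al c be, D (u al c be) `<=` D al) ->
  (forall al c be, D (v al c be) `<=` D be) ->
  (forall al c be P, D (u al c be) P -> D (v al c be) P -> False) ->
  (forall al c be P, D al P -> ~ D be P -> D (u al c be) P) ->
  (forall al c be P, ~ D al P -> D c P -> D be P -> D (v al c be) P) ->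
  (forall al c c' be (P Q : lspectrum (lexG L F)), P `<=` Q -> D be P ->
     ~ D (u al c be) P -> ~ D (v al c be) P ->
     ~ D (u al c' be) P -> ~ D (v al c' be) P -> D c Q -> D c' Q) ->
  False.
Proof.
move=> L_unc F_free D_co D_surj u_al v_be uv_disj u_pos v_pos quot_uniq.
have [tau tauP] := free_to_terms F_free.
have h_hom w : nonneg_vec w -> lgroup_hom (fun f => evalZ w (tau f)).
  by move=> [w1 w2 _]; have [] := tauP w w1 w2.
have h_ab w : nonneg_vec w -> evalZ w (tau a) = w.1 /\ evalZ w (tau b) = w.2.
  by move=> [w1 w2 _]; have [] := tauP w w1 w2.
have h_nz w : nonneg_vec w -> exists f, evalZ w (tau f) <> 0.
  move=> wP; have [ha hb] := h_ab w wP; have [_ _ w0] := wP.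
  have [wa|wa] := eqVneq w.1 0; last by exists a; rewrite ha; exact/eqP.
  exists b; rewrite hb => wb; apply: w0.
  by rewrite [w]surjective_pairing wa wb.
pose ray w (wP : nonneg_vec w) : lspectrum (lexG L F) :=
  LSpectrum (ray_set_prime L (h_hom w wP) (h_nz w wP)).
have snd_ray w wP f : lspectrum_set (ray w wP) (0, f) <-> evalZ w (tau f) = 0.
  by split=> [[]|].
have gen_co (g : lexG L F) : exists t, D t = lspectrum_D g.
  apply: D_surj; split; [exact: compact_lspectrum_D|exact: open_lspectrum_D].
have [al alE] := gen_co ((0, a) : lexG L F).
have [be beE] := gen_co ((0, b) : lexG L F).
have [c cE] := choice (fun xi => gen_co (gen F xi)).
have al_be w wP : ~ D al (ray w wP) -> ~ D be (ray w wP) -> False.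
  rewrite alE beE => /contrapT/snd_ray wa /contrapT/snd_ray wb.
  have [ha hb] := h_ab w wP; have [_ _] := wP; apply.
  by rewrite [w]surjective_pairing -ha -hb wa wb.
(* In the intended reading, [al] equals [c xi] times [be] up to signs modulo the prime of the ray
   [w]. *)
pose hit xi w := exists wP : nonneg_vec w,
  ~ D (u al (c xi) be) (ray w wP) /\ ~ D (v al (c xi) be) (ray w wP).
have hit_uniq xi eta w : hit xi w -> hit eta w -> (xi < eta)%O -> False.
  move=> [wP [uxi vxi]] [wP' []]; rewrite -(Prop_irrelevance wP wP').
  (* If [be] vanished at the ray, [al] would not, and [u] would be nonzero there. *)
  move=> ueta veta xe; have be_ray : D be (ray w wP).
    apply: contrapT => nbe; apply: uxi; apply: u_pos (nbe).
    by apply: contrapT => nal; exact: al_be nal nbe.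
  have ray_tail : ray w wP `<=` tail F eta.
    by case=> x f [/= -> _]; exact: tail_snd.
  have := quot_uniq _ _ _ _ _ _ ray_tail be_ray ueta veta uxi vxi.
  rewrite !cE /lspectrum_D /= => /(_ _ ((tail_gen F eta xi).2 xe)); apply.
  by move=> /(tail_gen F eta eta).1; rewrite ltxx.
have [xi nhit] : exists xi, forall w, ~ hit xi w.
  apply: contra_notP L_unc => nex.
  have /choice[r rP] : forall xi, exists w, hit xi w.
    move=> xi; apply: contra_notP nex => nh; exists xi => w hw.
    by apply: nh; exists w.
  apply/countable_injP; exists (pickle \o r) => xi eta _ _ /(pcan_inj pickleK) e.
  have he := rP eta; rewrite -e in he.
  by have [xe|ex|//] := ltgtP xi eta;
    [case: (hit_uniq _ _ _ (rP xi) he xe)|case: (hit_uniq _ _ _ he (rP xi) ex)].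
(* Every tail contains [F], so [D t] contains no tail. Hence the elements defining it lie in all
   tails, that is, in [F], and on rays they act as terms. *)
have terms t f : D t `<=` lspectrum_D ((0, f) : lexG L F) -> exists ts : seq term,
    forall w wP, D t (ray w wP) <-> exists2 q, q \in ts & evalZ w q != 0.
  move=> t_f; have [s sE] := compact_open_lspectrumP (D_co t).
  have s1 g : g \in s -> g.1 = 0.
    move=> gs; apply: tail_all => zeta; apply: contrapT => ng.
    have : D t (tail F zeta) by rewrite sE; exists g.
    by move=> /t_f; apply; exact: tail_snd.
  exists [seq tau g.2 | g <- s] => w wP; rewrite sE; split.
    move=> [g gs ng]; exists (tau g.2); first exact: map_f.
    by apply/eqP => g0; apply: ng; split=> //; exact: s1.
  move=> [_ /mapP[g gs ->] /eqP ng]; exists g => // -[_]; exact: ng.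
have [|ss ssP] := terms (u al (c xi) be) a; first by rewrite -alE.
have [|ts tsP] := terms (v al (c xi) be) b; first by rewrite -beE.
have e1 : nonneg_vec (1, 0) by split.
have e2 : nonneg_vec (0, 1) by split.
(* At [(0, 1)] the element [al] vanishes while [c xi] and [be] do not. *)
have v_e2 : D (v al (c xi) be) (ray _ e2).
  have [ha hb] := h_ab _ e2; apply: v_pos.
  - by rewrite alE; apply; apply/snd_ray.
  - by rewrite cE => -[/= /(congr1 (coeff xi))]; rewrite coeffU coeff0 eqxx.
  - by rewrite beE => /snd_ray; rewrite hb.
(* Disjointness from [v] makes [ss] vanish at [(0, 1)], and the choice of [xi] makes the two
   families cover all rays. *)
have [|||w [wP /(ssP _ wP) uw /(tsP _ wP) vw]] :=
    @nonvanishing_overlap ss ts _ _ e1 e2; last exact: uv_disj uw vw.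
- apply/(ssP _ e1); have [ha hb] := h_ab _ e1; apply: u_pos.
    by rewrite alE => /snd_ray; rewrite ha.
  by rewrite beE; apply; apply/snd_ray.
- move=> t tss; apply/eqP/negPn/negP => nt; apply: uv_disj v_e2.
  by apply/ssP; exists t.
- move=> w wP; apply: contrapT => nw; apply: (nhit w); exists wP.
  by split=> [/ssP|/tsP] [t tin nt]; apply: nw; exists t => //;
    rewrite mem_cat tin ?orbT.
Qed.

(** * The order unit *)

Section OrderUnit.
Variables (d : Order.disp_t) (L : orderType d) (F : abLGroupType).

Lemma lexG_order_unit (top : L) : (forall xi, (xi <= top)%O) ->
  order_unit (gen F top).
Proof.
move=> topP; have pos (x : lexZ L) : 0 < coeff top x -> 0 < x.
  move=> x_top; rewrite lt_neqAle lexZ_le0E; apply/andP; split.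
    by apply: contraTneq x_top => <-; rewrite coeff0 ltxx.
  apply/lexZ_ge0P; right; exists top => // eta.
  by rewrite ltNge topP.
have genMn n : (gen F top *+ n).1 = (gen F top).1 *+ n.
  by elim: n => // n IH; rewrite !mulrS -IH.
split; first by rewrite lexprod_le0E /lexprod_ge0 pos// coeffU eqxx.
(* The extra one keeps the top coefficient of the difference strictly positive, so the first
   coordinate alone decides. *)
move=> x; exists `|coeff top x.1|.+1; rewrite -lg_subr_ge0 lexprod_le0E.
apply/orP; left; apply: pos.
rewrite -[(_ - x).1]/((gen F top *+ _).1 - x.1) genMn coeffB coeffMn coeffU eqxx.
by lia.
Qed.

End OrderUnit.

(** * Reduction to totally ordered residue domains *)

Definition cone_support (V : zmodType) (N : set V) : set V :=
  [set x | N x /\ N (- x)].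

(* [val P t] is a representative in [V] of the value of [t] at [P], in the
   totally ordered domain obtained from [V] by quotienting by the support of
   the cone [N P]. *)
Lemma no_ordered_parametrization (d : Order.disp_t) (L : orderType d)
    (F : abLGroupType) (a b : F) (V : zmodType) (mul : V -> V -> V) (T : Type)
    (N : lspectrum (lexG L F) -> set V) (val : lspectrum (lexG L F) -> T -> V)
    (abs : T -> T) (u v : T -> T -> T -> T) :
  let D t := [set P | ~ cone_support (N P) (val P t)] in
  ~ countable [set: L] -> free_on_two_nonneg a b ->
  left_distributive mul +%R -> commutative mul ->
  (forall P, N P 0) ->
  (forall P x y, N P x -> N P y -> N P (x + y)) ->
  (forall P x y, N P x -> N P y -> N P (mul x y)) ->
  (forall P x, N P x \/ N P (- x)) ->
  (forall P x y, cone_support (N P) x -> cone_support (N P) (mul y x)) ->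
  (forall P x y, cone_support (N P) (mul x y) ->
     cone_support (N P) x \/ cone_support (N P) y) ->
  (forall P Q : lspectrum (lexG L F), P `<=` Q -> N P `<=` N Q) ->
  (forall (P Q : lspectrum (lexG L F)) t, P `<=` Q ->
     cone_support (N Q) (val Q t - val P t)) ->
  (forall P t, N P (val P (abs t))) ->
  (forall P t, cone_support (N P) (val P (abs t)) <->
     cone_support (N P) (val P t)) ->
  (forall P al c be, cone_support (N P) (val P (u al c be)) <->
     N P (mul (val P (abs c)) (val P (abs be)) - val P (abs al))) ->
  (forall P al c be, cone_support (N P) (val P (v al c be)) <->
     N P (val P (abs al) - mul (val P (abs c)) (val P (abs be)))) ->
  (forall t, Defs.compact_open (D t)) ->
  (forall U, Defs.compact_open U -> exists t, D t = U) ->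
  False.
Proof.
move=> D L_unc F_free mulDl mulC N0 ND NM N_total supp_mul supp_prime N_mono
  val_mono abs_ge0 abs_supp u_supp v_supp D_co D_surj.
have suppD P x y : cone_support (N P) x -> cone_support (N P) y ->
    cone_support (N P) (x + y).
  by move=> [x0 x0'] [y0 y0']; split; [|rewrite opprD]; exact: ND.
have suppN P x : cone_support (N P) x -> cone_support (N P) (- x).
  by move=> [x0 x0']; split; rewrite ?opprK.
have mul0l x : mul 0 x = 0 by apply: (addrI (mul 0 x)); rewrite -mulDl !addr0.
have mulNl x y : mul (- x) y = - mul x y.
  by apply: (addrI (mul x y)); rewrite -mulDl !subrr mul0l.
have supp_abs P t : D t P -> ~ cone_support (N P) (val P (abs t)).
  by move=> nt /abs_supp.
have Nsupp P t : ~ D t P -> cone_support (N P) (val P (abs t)).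
  by move=> /contrapT/abs_supp.
apply: (@no_semialgebraic_parametrization _ _ _ a b T D u v) => //.
- move=> al c be P nu /abs_supp[al0 al0']; apply/nu/u_supp.
  by apply: ND => //; apply: NM.
- move=> al c be P nv /abs_supp be0; apply/nv/v_supp.
  by apply: ND => //; have [] := supp_mul P _ (val P (abs c)) be0.
- move=> al c be P nu nv.
  have [w0|w0] := N_total P (val P (abs al) - mul (val P (abs c)) (val P (abs be))).
    by apply/nv/v_supp.
  by apply/nu/u_supp; rewrite -opprB.
- move=> al c be P /supp_abs nal /Nsupp be0 /u_supp w0; apply: nal; split=> //.
  have [_ m0] := supp_mul P _ (val P (abs c)) be0.
  by have := ND _ _ _ w0 m0; rewrite addrAC subrr add0r.
- move=> al c be P /Nsupp[_ al0] /supp_abs nc /supp_abs nbe /v_supp w0.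
  have [] := supp_prime P (val P (abs c)) (val P (abs be)) => //; split.
    exact: NM.
  by have := ND _ _ _ w0 al0; rewrite addrAC subrr add0r.
- move=> al c c' be P Q PQ /supp_abs nbe.
  move=> /contrapT/u_supp u1 /contrapT/v_supp v1 /contrapT/u_supp u2 /contrapT/v_supp v2.
  (* The four inequalities put the product of [abs c - abs c'] and [abs be] in the support at [P];
     primality cancels [abs be]. *)
  have := ND _ _ _ u1 v2; have := ND _ _ _ u2 v1.
  rewrite !subrKA -!mulNl -!mulDl => m1 m2.
  have [|[z1 z2]|] := supp_prime P (val P (abs c) - val P (abs c')) (val P (abs be)).
  + by split; rewrite // -mulNl opprB.
  + move=> nc /abs_supp c'0; apply: nc; apply/abs_supp.
    have cc' : cone_support (N Q) (val P (abs c) - val P (abs c')).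
      by split; exact: (N_mono _ _ PQ).
    (* Exchanging representatives at [P] for those at [Q] costs only elements of the support at
       [Q]. *)
    have -> : val Q (abs c) = (val Q (abs c) - val P (abs c)) +
        (val P (abs c) - val P (abs c')) -
        (val Q (abs c') - val P (abs c')) + val Q (abs c').
      by rewrite !subrKA opprB addrA subrK subrK.
    apply/suppD => //; apply/suppD; last exact/suppN/val_mono.
    by apply/suppD => //; exact: val_mono.
  + by [].
Qed.

(** * Brumfiel spectra *)

Section Brumfiel.
Variable A : comFRingType.
Implicit Types x y z : A.

Definition brumfiel_D x : set (brumfiel_spectrum A) :=
  [set P | ~ brumfiel_set P x].

Lemma open_brumfiel_D x : open (brumfiel_D x).
Proof.
exists [set x] => //; apply/seteqP; split=> P /= nP; last by move/(_ x erefl).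
by move=> Px; apply: nP => _ ->.
Qed.

Lemma open_brumfielE (U : set (brumfiel_spectrum A)) : open U ->
  forall P, U P -> exists2 x, brumfiel_D x P & brumfiel_D x `<=` U.
Proof.
move=> [I _ <-] P /= nP.
have [x Ix nPx] : exists2 x, I x & ~ brumfiel_set P x.
  apply: contra_notP nP => nP x Ix; apply: contra_notP nP => nPx.
  by exists x.
by exists x => // Q nQ IQ; apply: nQ; exact: IQ.
Qed.

(** Again an ultrafilter converges to the set of elements lying in almost every prime. *)
Lemma compact_brumfiel_D x : compact (brumfiel_D x).
Proof.
rewrite compact_ultra => F UF Fx.
pose S := [set y | F [set P | brumfiel_set P y]].
have nSx : ~ S x.
  by move=> Sx; have [P []] := filter_ex (filterI Fx Sx).
have Sp : fring_prime_lideal S.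
  split; last 2 first.
  - by move=> ST; apply: nSx; rewrite ST.
  - move=> y z Syz; apply: ultra_setU; apply: filterS Syz => P /=.
    by have [_ _ Pp] := brumfiel_prime P; exact: Pp.
  split; last first.
    by move=> y z Sz; split; apply: filterS Sz => P Pz;
      have [[_ PM] _ _] := brumfiel_prime P; have [] := PM y z Pz.
  split; [split| |].
  - by apply: filterS filterT => P _; have [[[[]]]] := brumfiel_prime P.
  - move=> y z Sy Sz; apply: filterS (filterI Sy Sz) => P [/= Py Pz].
    by have [[[[_ PD _] _ _] _] _ _] := brumfiel_prime P; exact: PD.
  - move=> y; apply: filterS => P /=.
    by have [[[[_ _ PN] _ _] _] _ _] := brumfiel_prime P; exact: PN.
  - move=> y z Sy Sz; split; apply: filterS (filterI Sy Sz) => P [/= Py Pz];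
      by have [[[_ PL _] _] _ _] := brumfiel_prime P; have [] := PL _ _ Py Pz.
  - move=> t y z St Sz ty yz; apply: filterS (filterI St Sz) => P [/= Pt Pz].
    by have [[[_ _ Pc] _] _ _] := brumfiel_prime P; exact: (Pc t y z).
exists (BrumfielSpectrum Sp); split=> //= V; rewrite nbhsE => -[U [oU UP] UV].
have [h nSh hU] := open_brumfielE oU UP.
apply: filterS (subset_trans hU UV) _; exact: ultra_not nSh.
Qed.

Definition fpos x : A := lg_join x 0.
Definition fabs x : A := fpos x + fpos (- x).

Lemma fpos_ge0 x : 0 <= fpos x. Proof. exact: lg_leUr. Qed.

Lemma fabs_ge0 x : 0 <= fabs x.
Proof. by rewrite -[0]addr0; apply: lg_leD; exact: fpos_ge0. Qed.

Lemma lr_mul0r x : lr_mul x 0 = 0.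
Proof. by apply: (addrI (lr_mul x 0)); rewrite -lr_mulDr !addr0. Qed.

Lemma lr_mul_ge0 x y : 0 <= x -> 0 <= y -> 0 <= lr_mul x y.
Proof. by move=> x0 y0; rewrite -(lr_mul0r x); exact: lr_le_mul2l. Qed.

Lemma lg_meetC x y : lg_meet x y = lg_meet y x.
Proof. by apply/le_anti; rewrite !lg_lexI !lg_leIl !lg_leIr. Qed.

(** Since [fpos (- x)] is at most [fpos x - x], subtracting the meet from [fpos x] still leaves an
    upper bound of [x] and 0. *)
Lemma meet_fpos x : lg_meet (fpos x) (fpos (- x)) = 0.
Proof.
set m := lg_meet _ _; apply/le_anti/andP; split; last by rewrite lg_lexI !fpos_ge0.
have posN : fpos (- x) <= fpos x - x.
  rewrite lg_leUx lg_subr_ge0 lg_leUl andbT -[X in X <= _]add0r.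
  by rewrite [leRHS]addrC [leLHS]addrC lg_leD2l// fpos_ge0.
have : fpos x <= fpos x - m.
  rewrite {1}/fpos lg_leUx lg_subr_ge0 lg_leIl andbT -lg_subr_ge0 addrAC.
  by rewrite lg_subr_ge0 (le_trans _ posN)// lg_leIr.
by move=> /(lg_leD2l _ _ (m - fpos x)); rewrite subrK subrKA subrr.
Qed.

(* Two uses of the f-ring axiom make the product disjoint from itself. *)
Lemma mul_fpos x : lr_mul (fpos x) (fpos (- x)) = 0.
Proof.
have p0 := fpos_ge0 x; have n0 := fpos_ge0 (- x).
have [_ h] := fr_meet_mul _ _ _ p0 n0 p0 (meet_fpos x).
have [h' _] := fr_meet_mul _ _ _ (lr_mul_ge0 p0 n0) p0 n0 (etrans (lg_meetC _ _) h).
by rewrite -h'; apply/le_anti; rewrite lg_lexI lexx lg_leIl.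
Qed.

Section Prime.
Variable P : brumfiel_spectrum A.

Lemma brumfiel0 : brumfiel_set P 0.
Proof. by have [[[[]]]] := brumfiel_prime P. Qed.

Lemma brumfielD x y : brumfiel_set P x -> brumfiel_set P y -> brumfiel_set P (x + y).
Proof. by have [[[[_ PD _] _ _] _] _ _] := brumfiel_prime P; exact: PD. Qed.

Lemma brumfielN x : brumfiel_set P x -> brumfiel_set P (- x).
Proof. by have [[[[_ _ PN] _ _] _] _ _] := brumfiel_prime P; exact: PN. Qed.

Lemma brumfielM x y : brumfiel_set P y -> brumfiel_set P (lr_mul x y).
Proof. by have [[_ PM] _ _] := brumfiel_prime P => /(PM x)[]. Qed.

Lemma brumfiel_convex x y z : brumfiel_set P x -> brumfiel_set P z ->
  x <= y -> y <= z -> brumfiel_set P y.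
Proof. by have [[[_ _ Pc] _] _ _] := brumfiel_prime P; exact: Pc. Qed.

Lemma brumfiel_fpos x : brumfiel_set P x -> brumfiel_set P (fpos x).
Proof.
have [[[_ PL _] _] _ _] := brumfiel_prime P => Px.
by have [] := PL _ _ Px brumfiel0.
Qed.

Lemma brumfiel_fabs x : brumfiel_set P (fabs x) <-> brumfiel_set P x.
Proof.
split=> Px; last by apply: brumfielD; apply: brumfiel_fpos => //; exact: brumfielN.
apply: (brumfiel_convex (brumfielN Px) Px).
  rewrite -[leRHS]opprK; apply: lg_leN2; rewrite -[leLHS]add0r.
  by apply: lg_leD; [exact: fpos_ge0|exact: lg_leUl].
by rewrite -[leLHS]addr0; apply: lg_leD; [exact: lg_leUl|exact: fpos_ge0].
Qed.

Lemma brumfielD_ge0 x y : 0 <= x -> 0 <= y ->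
  brumfiel_set P (x + y) <-> brumfiel_set P x /\ brumfiel_set P y.
Proof.
move=> x0 y0; split=> [Pxy|[]]; last exact: brumfielD.
split; apply: (brumfiel_convex brumfiel0 Pxy) => //.
  by rewrite -[leLHS]addr0; apply: lg_leD2l.
by rewrite -[leLHS]add0r; apply: lg_leD.
Qed.

(** The preimage of the positive cone of the quotient by [P]. *)
Definition brumfiel_cone : set A := [set x | exists2 p, brumfiel_set P p & p <= x].

Lemma brumfiel_cone_ge0 x : 0 <= x -> brumfiel_cone x.
Proof. by exists 0 => //; exact: brumfiel0. Qed.

Lemma fpos_cone x : brumfiel_set P (fpos x) <-> brumfiel_cone (- x).
Proof.
split=> [Px|[p Pp px]].
  by exists (- fpos x); [exact: brumfielN|apply: lg_leN2; exact: lg_leUl].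
apply: (brumfiel_convex brumfiel0 (brumfiel_fpos (brumfielN Pp))).
  exact: fpos_ge0.
rewrite lg_leUx lg_leUr andbT (le_trans _ (lg_leUl _ _))//.
by rewrite -[leLHS]opprK; exact: lg_leN2.
Qed.

Lemma brumfiel_cone_support x :
  cone_support brumfiel_cone x <-> brumfiel_set P x.
Proof.
split=> [[[p Pp px] [q Qq qx]]|Px].
  apply: (brumfiel_convex Pp (brumfielN Qq) px).
  by rewrite -[leLHS]opprK; exact: lg_leN2.
by split; [exists x|exists (- x)] => //; exact: brumfielN.
Qed.

Lemma brumfiel_coneD x y : brumfiel_cone x -> brumfiel_cone y -> brumfiel_cone (x + y).
Proof.
move=> [p Pp px] [q Pq qy]; exists (p + q); first exact: brumfielD.
exact: lg_leD.
Qed.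

(** The positive and negative parts multiply to zero, so the prime [P] contains one of them. *)
Lemma brumfiel_cone_total x : brumfiel_cone x \/ brumfiel_cone (- x).
Proof.
have [_ _ Pp] := brumfiel_prime P.
have /Pp[] : brumfiel_set P (lr_mul (fpos x) (fpos (- x))).
- by rewrite mul_fpos; exact: brumfiel0.
- by right; apply/fpos_cone.
- by left; rewrite -[x]opprK; apply/fpos_cone.
Qed.

Lemma lr_mulN x y : lr_mul x (- y) = - lr_mul x y.
Proof. by apply: (addrI (lr_mul x y)); rewrite -lr_mulDr !subrr lr_mul0r. Qed.

Lemma brumfiel_coneM x y : brumfiel_cone x -> brumfiel_cone y ->
  brumfiel_cone (lr_mul x y).
Proof.
have split_pos z : brumfiel_cone z -> exists2 p, brumfiel_set P p & 0 <= z - p.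
  by move=> [p Pp pz]; exists p => //; rewrite lg_subr_ge0.
move=> /split_pos[p Pp xp] /split_pos[q Pq yq].
(* Passing to the nonnegative representatives [x - p] and [y - q] changes the product by an element
   of [P]. *)
have -> : lr_mul x y = lr_mul (x - p) (y - q) + (lr_mul y p + lr_mul (x - p) q).
  by rewrite addrCA -lr_mulDr subrK (fr_mulC y) -lr_mulDl [p + _]addrC subrK.
apply: brumfiel_coneD; first exact/brumfiel_cone_ge0/lr_mul_ge0.
have /brumfiel_cone_support[] // : brumfiel_set P (lr_mul y p + lr_mul (x - p) q).
by apply: brumfielD; exact: brumfielM.
Qed.

End Prime.

Lemma no_brumfiel_embedding (d : Order.disp_t) (L : orderType d)
    (F : abLGroupType) (a b : F) :
  ~ countable [set: L] -> free_on_two_nonneg a b ->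
  ~ embeds_as_spectral_subspace (lspectrum (lexG L F)) (brumfiel_spectrum A).
Proof.
move=> L_unc F_free /embeds_as_spectral_subspaceP[e [e_co e_open]].
have D_open x : open (e @^-1` brumfiel_D x).
  by apply/e_open; exists (brumfiel_D x) => //; exact: open_brumfiel_D.
have e_mono (P Q : lspectrum (lexG L F)) :
    P `<=` Q -> brumfiel_set (e P) `<=` brumfiel_set (e Q).
  move=> PQ x Px; apply: contrapT => nQx.
  exact: (open_lspectrum_generization (D_open x) PQ nQx Px).
pose w al c be : A := fabs al - lr_mul (fabs c) (fabs be).
have suppE P x : cone_support (brumfiel_cone (e P)) x <-> brumfiel_set (e P) x.
  exact: brumfiel_cone_support.
have DE x : [set P | ~ cone_support (brumfiel_cone (e P)) x] = e @^-1` brumfiel_D x.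
  by apply/seteqP; split=> P /= nP Px; apply: nP; apply/suppE.
(* Ring elements serve as their own values at every prime; only the cone varies. *)
apply: (@no_ordered_parametrization _ L F a b A (@lr_mul A) A
  (fun P => brumfiel_cone (e P)) (fun _ x => x) (@fabs)
  (fun al c be => fpos (w al c be)) (fun al c be => fpos (- w al c be))) => //.
- exact: lr_mulDl.
- exact: fr_mulC.
- by move=> P; exact: brumfiel_cone_ge0.
- by move=> P x y; exact: brumfiel_coneD.
- by move=> P x y; exact: brumfiel_coneM.
- by move=> P x; exact: brumfiel_cone_total.
- by move=> P x y /suppE Px; apply/suppE; exact: brumfielM.
- move=> P x y /suppE; have [_ _ Pp] := brumfiel_prime (e P).
  by move=> /Pp[] /suppE; [left|right].
- by move=> P Q /e_mono PQ x [p Pp px]; exists p => //; exact: PQ.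
- by move=> P Q x _; apply/suppE; rewrite subrr; exact: brumfiel0.
- by move=> P x; apply/brumfiel_cone_ge0/fabs_ge0.
- by move=> P x; split=> /suppE Px; apply/suppE; apply/brumfiel_fabs.
- by move=> P al c be; split=> [/suppE/fpos_cone|Pw];
    [|apply/suppE/fpos_cone]; rewrite opprB.
- by move=> P al c be; split=> [/suppE/fpos_cone|Pw];
    [|apply/suppE/fpos_cone]; rewrite opprK.
- move=> x; rewrite DE; apply: e_co; split.
    exact: compact_brumfiel_D.
  exact: open_brumfiel_D.
apply: compact_open_basisP => [x||x y|U P].
- by rewrite DE.
- exists 0; apply/seteqP; split=> // P; apply; apply/suppE; exact: brumfiel0.
(* By convexity a sum of nonnegative elements lies in a prime only if both summands do, so it cuts
   out the union. *)
- exists (fabs x + fabs y); rewrite !DE; apply/seteqP; split=> P /=.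
    move=> nP; apply: contra_notP nP => /not_orP[/contrapT Px /contrapT Py].
    by apply: brumfielD; apply/brumfiel_fabs.
  by move=> nP /(brumfielD_ge0 _ (fabs_ge0 x) (fabs_ge0 y))[
    /brumfiel_fabs Px /brumfiel_fabs Py]; case: nP.
- move=> /e_open[V oV ->] VP; have [x xP xV] := open_brumfielE oV VP.
  by exists x; rewrite DE // => Q; exact: xV.
Qed.

End Brumfiel.

(** * Real spectra *)

(* Lattice-ring terms play the role of the universal f-ring of [R]. *)
Inductive rterm (R : Type) : Type :=
  | rcst of R
  | rsub of rterm R & rterm R
  | rmul of rterm R & rterm R
  | rmax of rterm R & rterm R.

Section RealSpectrum.
Variable R : comPzRingType.
Implicit Types (x y : R) (t s : rterm R).
Local Notation cone_of P := (real_spectrum_set P).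
Local Notation supp P := (cone_support (cone_of P)).

(* The value of [t] at [P] lives in [R / supp P]; since [rmax] selects one of its
   arguments, a representative can be chosen in [R] itself. *)
Fixpoint rval (P : set R) t : R :=
  match t with
  | rcst x => x
  | rsub t s => rval P t - rval P s
  | rmul t s => rval P t * rval P s
  | rmax t s => if `[< P (rval P t - rval P s) >] then rval P t else rval P s
  end.

Definition rpos t := rmax t (rcst 0).
Definition ropp t := rsub (rcst 0) t.
Definition rabs t := rmax t (ropp t).

Section PrimeCone.
Variable P : real_spectrum R.

Lemma prime_coneD x y : cone_of P x -> cone_of P y -> cone_of P (x + y).
Proof. by have [[[_ PD] _ _] _ _] := real_spectrum_prime P; exact: PD. Qed.

Lemma prime_coneM x y : cone_of P x -> cone_of P y -> cone_of P (x * y).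
Proof. by have [[_ [_ PM] _] _ _] := real_spectrum_prime P; exact: PM. Qed.

Lemma prime_cone0 : cone_of P 0.
Proof. by have [[[]]] := real_spectrum_prime P. Qed.

Lemma prime_cone1 : cone_of P 1.
Proof. by have [[_ []]] := real_spectrum_prime P. Qed.

Lemma prime_cone_sqr x : cone_of P (x * x).
Proof. by have [[_ _ Psq] _ _] := real_spectrum_prime P; rewrite -expr2. Qed.

Lemma prime_cone_total x : cone_of P x \/ cone_of P (- x).
Proof. by have [_ Pt _] := real_spectrum_prime P. Qed.

Lemma prime_coneN x : ~ cone_of P x -> cone_of P (- x).
Proof. by have [] := prime_cone_total x. Qed.

Lemma suppD x y : supp P x -> supp P y -> supp P (x + y).
Proof. by have [_ _ [[_ ID _] _ _]] := real_spectrum_prime P; exact: ID. Qed.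

Lemma suppM x y : supp P y -> supp P (x * y).
Proof. by have [_ _ [[_ _ IM] _ _]] := real_spectrum_prime P; exact: IM. Qed.

Lemma supp0 : supp P 0.
Proof. by have [_ _ [[]]] := real_spectrum_prime P. Qed.

Lemma suppN x : supp P x -> supp P (- x).
Proof. by move=> /(suppM (-1)); rewrite mulN1r. Qed.

Lemma supp_prime x y : supp P (x * y) -> supp P x \/ supp P y.
Proof. by have [_ _ [_ _ Ip]] := real_spectrum_prime P; exact: Ip. Qed.

Lemma supp1 : ~ supp P 1.
Proof.
move=> I1; have [_ _ [_ IT _]] := real_spectrum_prime P; apply: IT.
by apply/seteqP; split=> // x _; have := suppM x I1; rewrite mulr1.
Qed.

Lemma supp_opp x : supp P (- x) <-> supp P x.
Proof. by split=> /suppN //; rewrite opprK. Qed.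

Lemma rval_abs_ge0 t : cone_of P (rval P (rabs t)).
Proof.
rewrite /= sub0r opprK; set x := rval P t.
case: asboolP => [Pxx|/prime_coneN Nxx].
  have [//|Nx] := prime_cone_total x.
  by have := prime_coneD Pxx Nx; rewrite addrK.
have [Px|//] := prime_cone_total x.
by have := prime_coneD Nxx Px; rewrite opprD addrNK.
Qed.

Lemma rval_abs_supp t : supp P (rval P (rabs t)) <-> supp P (rval P t).
Proof. by rewrite /= sub0r; case: ifP => _ //; exact: supp_opp. Qed.

Lemma rval_pos_supp t : supp P (rval P (rpos t)) <-> cone_of P (- rval P t).
Proof.
rewrite /= subr0; case: asboolP => [Px|/prime_coneN Nx].
  by split=> [[]|].
by split=> // _; exact: supp0.
Qed.

(** The term is a sum of two squares, written with a double negation; in an ordered domain it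
    vanishes only if both squares do. It expresses unions of cozero sets. *)
Lemma rval_sqr_supp t s :
  supp P (rval P (rsub (rmul t t) (ropp (rmul s s)))) <->
  supp P (rval P t) /\ supp P (rval P s).
Proof.
rewrite /= sub0r opprK; set x := rval P t; set y := rval P s.
have key (u v : R) : supp P (u * u + v * v) -> supp P u.
  move=> [_ uv]; suff : supp P (u * u) by case/supp_prime.
  split; first exact: prime_cone_sqr.
  by have := prime_coneD uv (prime_cone_sqr v); rewrite opprD subrK.
split=> [xy|[Px Py]]; last by apply: suppD; exact: suppM.
by split; [exact: key xy|apply: (key _ x); rewrite addrC].
Qed.

End PrimeCone.

(** The delicate case is [rmax]: if [P] and [Q] select different arguments, inequalities in both
    directions hold at [Q], so the arguments agree modulo its support. *)
Lemma rval_mono (P Q : real_spectrum R) t : P `<=` Q ->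
  supp Q (rval Q t - rval P t).
Proof.
move=> PQ; elim: t => [x|t IHt s IHs|t IHt s IHs|t IHt s IHs] /=.
- by rewrite subrr; exact: supp0.
- by rewrite opprD addrACA -opprD; apply: suppD IHt (suppN IHs).
- have -> : rval Q t * rval Q s - rval P t * rval P s =
    rval Q t * (rval Q s - rval P s) + rval P s * (rval Q t - rval P t) by ring.
  by apply: suppD; exact: suppM.
have [[tp tn] [sp sn]] := (IHt, IHs).
case: (asboolP (cone_of P _)) => [/PQ Pts|/prime_coneN/PQ Pst].
  rewrite asboolT//; have := prime_coneD (prime_coneD Pts tp) sn.
  by congr (cone_of Q); ring.
rewrite opprB in Pst.
have Qst : cone_of Q (rval Q s - rval Q t).
  have := prime_coneD (prime_coneD Pst sp) tn.
  by congr (cone_of Q); ring.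
case: (asboolP (cone_of Q _)) => // Qts.
have : supp Q (rval Q t - rval Q s) by split=> //; rewrite opprB.
by move=> /suppD/(_ IHs); rewrite subrKA.
Qed.

Lemma open_not_mem x : open [set P : real_spectrum R | ~ cone_of P x].
Proof.
exists [set [set P : real_spectrum R | ~ cone_of P x]]; last by rewrite bigcup_set1.
by move=> _ ->; apply: finI_from1; exists x.
Qed.

Lemma open_real_spectrumE (U : set (real_spectrum R)) (P : real_spectrum R) :
  open U -> U P -> exists2 l : seq R, (forall x, x \in l -> ~ cone_of P x) &
    forall Q : real_spectrum R, (forall x, x \in l -> ~ cone_of Q x) -> U Q.
Proof.
have subbase (l : seq (set (real_spectrum R))) :
    (forall V, V \in l -> real_spectrum_subbase V) -> exists k : seq R,
    forall Q : real_spectrum R,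
      (forall V, V \in l -> V Q) <-> (forall x, x \in k -> ~ cone_of Q x).
  elim: l => [|V l IH] lP; first by exists [::].
  have [W Wl|k kP] := IH; first by apply: lP; rewrite inE Wl orbT.
  have [x _ VE] := lP V (mem_head _ _).
  exists (x :: k) => Q; split=> h y; rewrite inE => /orP[/eqP ->|].
  - by have := h V (mem_head _ _); rewrite -VE.
  - by apply: (kP Q).1 => W Wl; apply: h; rewrite inE Wl orbT.
  - by rewrite -VE; apply: h; exact: mem_head.
  - by apply: (kP Q).2 => z zk; apply: h; rewrite inE zk orbT.
move=> [D' sD' <-] [V D'V]; have [s sD sE] := sD' _ D'V; rewrite -sE => sP.
have [W Ws|k kP] := subbase (finmap.enum_fset s); first by have := sD W Ws; rewrite inE.
exists k; first by apply/(kP P).1 => W Ws; exact: sP.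
move=> Q /(kP Q).2 h; exists V => //.
suff : (V : set (real_spectrum R)) Q by [].
by rewrite -sE => W; exact: h.
Qed.

Section UltraLimit.
Variable F : set_system (real_spectrum R).
Hypothesis UF : UltraFilter F.

Definition ultra_limit_set : set R := [set x | F [set P | cone_of P x]].

Lemma ultra_limit_prime : prime_cone ultra_limit_set.
Proof.
have all_points (S : set (real_spectrum R)) : (forall P, S P) -> F S.
  by move=> h; apply: filterS filterT => P _.
split.
- split.
  + split; first by apply: all_points => P; exact: prime_cone0.
    move=> x y Fx Fy; apply: filterS (filterI Fx Fy) => P [].
    exact: prime_coneD.
  + split; first by apply: all_points => P; exact: prime_cone1.
    move=> x y Fx Fy; apply: filterS (filterI Fx Fy) => P [].
    exact: prime_coneM.
  + by move=> x; apply: all_points => P; rewrite /= expr2; exact: prime_cone_sqr.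
- move=> x; apply: ultra_setU; apply: all_points => P; exact: prime_cone_total.
split; first split.
- split; apply: all_points => P; rewrite /= ?oppr0; exact: prime_cone0.
- move=> x y [Fx Fx'] [Fy Fy']; split.
    by apply: filterS (filterI Fx Fy) => P []; exact: prime_coneD.
  by apply: filterS (filterI Fx' Fy') => P []; rewrite /= opprD; exact: prime_coneD.
- move=> x y [Fy Fy']; split; apply: filterS (filterI Fy Fy') => P [Py Py'];
    by have [] := @suppM P x y (conj Py Py').
- move=> ST; have : [set x | ultra_limit_set x /\ ultra_limit_set (- x)] 1.
    by rewrite ST.
  move=> [F1 F1']; have [P [P1 P1']] := filter_ex (filterI F1 F1').
  exact: (@supp1 P).
- move=> x y [Fxy Fxy'].
  have : F ([set P : real_spectrum R | supp P x] `|` [set P | supp P y]).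
    apply: filterS (filterI Fxy Fxy') => P [Pxy Pxy'].
    exact: (@supp_prime P x y).
  move=> /(ultra_setU UF)[] h; [left|right]; split; by apply: filterS h => P [].
Qed.

Definition ultra_limit := RealSpectrum ultra_limit_prime.

(** A term makes finitely many selections, each settled as in the limit at almost every point, so
    the chosen representatives are literally equal there. *)
Lemma rval_ultra_limit t : exists2 r, rval ultra_limit t = r &
  F [set Q : real_spectrum R | rval Q t = r].
Proof.
elim: t => [x|t [r <- IHt] s [r' <- IHs]|t [r <- IHt] s [r' <- IHs]
  |t [r <- IHt] s [r' <- IHs]] /=; eexists; try exact: erefl.
- by apply: filterS filterT => Q _.
- by apply: filterS (filterI IHt IHs) => Q [/= -> ->].
- by apply: filterS (filterI IHt IHs) => Q [/= -> ->].
- case: asboolP => [Fts|/(ultra_not UF) Fts];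
    apply: filterS (filterI Fts (filterI IHt IHs)) => Q [Qts [/= -> ->]].
    by rewrite asboolT.
  by rewrite asboolF.
Qed.

End UltraLimit.

Definition rterm_D t : set (real_spectrum R) := [set P | ~ supp P (rval P t)].

(** The sets [rterm_D t] and their complements are both closed under ultrafilter limits, which gives
    compactness and, with [rval_mono], openness. *)
Lemma rterm_D_ultra_limit (F : set_system (real_spectrum R))
    (UF : UltraFilter F) t : F (rterm_D t) <-> rterm_D t (ultra_limit UF).
Proof.
have [r rE Fr] := rval_ultra_limit UF t.
split=> [Ft|].
  rewrite /rterm_D /= rE => -[Sr Sr'].
  have [Q [[[Qt Qr] Qr1] Qr2]] := filter_ex (filterI (filterI (filterI Ft Fr) Sr) Sr').
  by apply: Qt; rewrite Qr.
move=> nS; have [//|FnD] := in_ultra_setVsetC (rterm_D t) UF.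
have Fsupp : F [set Q : real_spectrum R | supp Q r].
  by apply: filterS (filterI FnD Fr) => Q [/contrapT + Qr]; rewrite Qr.
by case: nS; rewrite rE; split; apply: filterS Fsupp => Q [].
Qed.

Lemma ultra_limit_cvg (F : set_system (real_spectrum R)) (UF : UltraFilter F) :
  F --> ultra_limit UF.
Proof.
move=> V; rewrite nbhsE => -[U [oU US] UV].
have [l lS lU] := open_real_spectrumE oU US.
suff : F [set Q : real_spectrum R | forall x, x \in l -> ~ cone_of Q x].
  by apply: filterS => Q /lU/UV.
elim: l lS {lU} => [|x l IH] lS; first by apply: filterS filterT.
have Fl : F [set Q : real_spectrum R | forall x, x \in l -> ~ cone_of Q x].
  by apply: IH => y yl; apply: lS; rewrite inE yl orbT.
have Fx := ultra_not UF (lS x (mem_head _ _)).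
apply: filterS (filterI Fx Fl) => Q [Qx Ql] y.
by rewrite inE => /orP[/eqP ->|/Ql].
Qed.

Lemma compact_rterm_D t : compact (rterm_D t).
Proof.
rewrite compact_ultra => F UF Ft; exists (ultra_limit UF); split.
  exact/rterm_D_ultra_limit.
exact: ultra_limit_cvg.
Qed.

(* Patch-closed and stable under specialization, hence closed. *)
Lemma open_rterm_D t : open (rterm_D t).
Proof.
rewrite -closedC => P; rewrite closureEcvg => -[G GF [GP KG]].
have [F [UF GsubF]] := ultraFilterLemma GF.
(* Convergence to [P] puts the limit cone inside [P], so a term vanishing at the limit vanishes at
   [P]. *)
have sub : ultra_limit UF `<=` P.
  move=> x Fx; apply: contrapT => nPx.
  have Fnx : F [set Q : real_spectrum R | ~ cone_of Q x].
    by apply/GsubF/GP/open_nbhs_nbhs; split=> //; exact: open_not_mem.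
  by have [Q []] := filter_ex (filterI Fx Fnx).
have FK : F (~` rterm_D t) by apply: GsubF; exact: KG.
move=> tP; have : rterm_D t (ultra_limit UF).
  move=> [/sub Px /sub Px']; apply: tP.
  by have := suppD (rval_mono t sub) (conj Px Px'); rewrite subrK.
by move=> /(rterm_D_ultra_limit UF t).2 Ft; have [Q []] := filter_ex (filterI Ft FK).
Qed.

(** An element [x] is outside a cone exactly when the positive part of [- x] is nonzero there;
    products of such parts encode finite intersections, starting from the constant 1. *)
Lemma rterm_D_basis (U : set (real_spectrum R)) (P : real_spectrum R) :
  open U -> U P -> exists2 t, rterm_D t P & rterm_D t `<=` U.
Proof.
move=> oU UP; have [l lP lU] := open_real_spectrumE oU UP.
suff [t tE] : exists t, forall Q : real_spectrum R, rterm_D t Q <->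
    forall x, x \in l -> ~ cone_of Q x.
  by exists t; [exact/tE|move=> Q /tE/lU].
elim: l {lP lU} => [|x l [t tE]].
  by exists (rcst 1) => Q; split=> // _; exact: supp1.
exists (rmul (rpos (rcst (- x))) t) => Q; split.
  move=> nQ y; rewrite inE => /orP[/eqP -> Qx|yl].
    have Qp : supp Q (rval Q (rpos (rcst (- x)))).
      by apply/rval_pos_supp; rewrite /= opprK.
    by apply: nQ; have := suppM (rval Q t) Qp; rewrite mulrC.
  by apply: (tE Q).1 y yl => Qt; apply: nQ; exact: suppM.
move=> h /(@supp_prime Q (rval Q (rpos (rcst (- x)))))[/rval_pos_supp|].
  by rewrite /= opprK; apply: h; exact: mem_head.
by apply: (tE Q).2 => y yl; apply: h; rewrite inE yl orbT.
Qed.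

Lemma no_real_embedding (d : Order.disp_t) (L : orderType d)
    (F : abLGroupType) (a b : F) :
  ~ countable [set: L] -> free_on_two_nonneg a b ->
  ~ embeds_as_spectral_subspace (lspectrum (lexG L F)) (real_spectrum R).
Proof.
move=> L_unc F_free /embeds_as_spectral_subspaceP[e [e_co e_open]].
have D_open t : open (e @^-1` rterm_D t).
  by apply/e_open; exists (rterm_D t) => //; exact: open_rterm_D.
have e_mono (P Q : lspectrum (lexG L F)) : P `<=` Q -> cone_of (e P) `<=` cone_of (e Q).
  move=> PQ x Px; apply: contrapT => nQx.
  have xo : open (e @^-1` [set S : real_spectrum R | ~ cone_of S x]).
    apply/e_open; exists [set S : real_spectrum R | ~ cone_of S x] => //.
    exact: open_not_mem.
  exact: (open_lspectrum_generization xo PQ nQx Px).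
pose w al c be := rsub (rabs al) (rmul (rabs c) (rabs be)).
apply: (@no_ordered_parametrization _ L F a b R *%R (rterm R)
  (fun P => cone_of (e P)) (fun P => rval (e P)) rabs
  (fun al c be => rpos (w al c be)) (fun al c be => rpos (ropp (w al c be)))) => //.
- exact: mulrDl.
- exact: mulrC.
- by move=> P; exact: prime_cone0.
- by move=> P; exact: prime_coneD.
- by move=> P; exact: prime_coneM.
- by move=> P; exact: prime_cone_total.
- by move=> P x y; exact: suppM.
- by move=> P; exact: supp_prime.
- by move=> P Q t /e_mono; exact: rval_mono.
- by move=> P; exact: rval_abs_ge0.
- by move=> P; exact: rval_abs_supp.
- by move=> P al c be; rewrite rval_pos_supp -opprB.
- by move=> P al c be; rewrite rval_pos_supp [rval _ (ropp _)]sub0r opprK.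
- move=> t; apply: (e_co (rterm_D t)); split.
    exact: compact_rterm_D.
  exact: open_rterm_D.
apply: compact_open_basisP => [t||t s|U P].
- exact: D_open.
- by exists (rcst 0); apply/seteqP; split=> // P; apply; exact: supp0.
- exists (rsub (rmul t t) (ropp (rmul s s))); apply/seteqP; split=> P /=.
    move=> nP; apply: contra_notP nP => /not_orP[/contrapT Pt /contrapT Ps].
    exact/rval_sqr_supp.
  by move=> nP /rval_sqr_supp[Pt Ps]; case: nP.
- move=> /e_open[V oV ->] VP; have [t tP tV] := rterm_D_basis oV VP.
  by exists t => // Q; exact: tV.
Qed.

End RealSpectrum.

Theorem corollary6p8 (d : Order.disp_t) (W : orderType d)
    (F : abLGroupType) (a b : F)
    (W_omega1 : is_omega1 W) (F_free : free_on_two_nonneg a b) :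
  (exists u : lexG (W^d)%type F, order_unit u) /\
  (forall A : comFRingType,
     ~ embeds_as_spectral_subspace (lspectrum (lexG (W^d)%type F))
         (brumfiel_spectrum A)) /\
  (forall R : comPzRingType,
     ~ embeds_as_spectral_subspace (lspectrum (lexG (W^d)%type F))
         (real_spectrum R)).
Proof.
have [W_wo W_unc _] := W_omega1.
split; last by split=> [A|R]; [exact: (no_brumfiel_embedding (L := W^d) W_unc F_free)
  |exact: (no_real_embedding (L := W^d) W_unc F_free)].
have [w _] : [set: W] !=set0.
  by apply/set0P/eqP => W0; apply: W_unc; rewrite W0.
(* The least element of [W] is the greatest of [W^d]. *)
have [|m [[_ m_min] _]] := W_wo predT; first by exists w.
by exists (gen F (m : W^d)); apply: lexG_order_unit => xi; exact: m_min.
Qed.
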